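(* Let $k$ be a finite field of characteristic $p$ with $q$ elements, $G=\mathrm{GL}_2(k)$, and $U$ the subgroup of upper triangular unipotent matrices. Let $C$ be the representation of $G$ over $\overline{\mathbf F}_p$ induced from the trivial character of $U$, and $H=\mathrm{End}_G(C)$. Then the left $H$-module $C$ is flat if and only if $q=p$.
   Context: $\overline{\mathbf F}_p$ is an algebraic closure of $k$. $C$ is the space of functions $G\to\overline{\mathbf F}_p$ invariant under left translations by $U$, with $G$ acting by right translations; it is a left $H$-module. *)

(* Defs.v *)
From HB Require Import structures.
From mathcomp Require Import all_boot all_order all_algebra all_fingroup all_field.
From mathcomp Require Import boolp functions.
From mathcomp Require Import generic_quotient ring_quotient freeg.

Set Implicit Arguments.
Unset Strict Implicit.
Unset Printing Implicit Defensive.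

Import GRing.Theory.
Local Open Scope ring_scope.
Local Open Scope quotient_scope.

(* Right R-modules are encoded as left modules over the converse ring R^c, so
   that the right action m . r is (r : R^c) *: m. *)

Section Tensor.

Variables (R : pzRingType) (M : lmodType R^c) (C : lmodType R).

Inductive tensor_rel : {freeg (M * C) / int} -> Prop :=
| TensorRel0 : tensor_rel 0
| TensorRelB x y : tensor_rel x -> tensor_rel y -> tensor_rel (x - y)
| TensorRelDl m m' c :
    tensor_rel (<< (m + m', c) >> - << (m, c) >> - << (m', c) >>)
| TensorRelDr m c c' :
    tensor_rel (<< (m, c + c') >> - << (m, c) >> - << (m, c') >>)
| TensorRelA m (r : R) c :
    tensor_rel (<< ((r : R^c) *: m, c) >> - << (m, r *: c) >>).

Definition tensor_ker : {pred {freeg (M * C) / int}} :=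
  fun x => `[< tensor_rel x >].

Fact tensor_ker_zmod_closed : zmod_closed tensor_ker.
Proof.
split=> [|x y /asboolP relx /asboolP rely]; apply/asboolP.
  exact: TensorRel0.
exact: TensorRelB.
Qed.

HB.instance Definition _ :=
  GRing.isZmodClosed.Build {freeg (M * C) / int} tensor_ker
    tensor_ker_zmod_closed.

Definition tensor := Quotient.quot tensor_ker.

HB.instance Definition _ := GRing.Zmodule.on tensor.

Definition tens (m : M) (c : C) : tensor := \pi_tensor << (m, c) >>.

Lemma pi_tensorB x y : \pi_tensor (x - y) = \pi_tensor x - \pi_tensor y.
Proof. by rewrite !piE. Qed.

Lemma pi_tensor_eq x y :
  (\pi_tensor x = \pi_tensor y) <-> tensor_rel (x - y).
Proof.
split=> [/eqP|relxy].
  by rewrite -Quotient.idealrBE => /asboolP.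
by apply/eqP; rewrite -Quotient.idealrBE; apply/asboolP.
Qed.

Lemma tensDl m m' c : tens (m + m') c = tens m c + tens m' c.
Proof.
apply/eqP; rewrite -subr_eq0 opprD addrA -!pi_tensorB.
have -> : 0 = \pi_tensor 0 by rewrite !piE.
by apply/eqP/pi_tensor_eq; rewrite subr0; apply: TensorRelDl.
Qed.

Lemma tensDr m c c' : tens m (c + c') = tens m c + tens m c'.
Proof.
apply/eqP; rewrite -subr_eq0 opprD addrA -!pi_tensorB.
have -> : 0 = \pi_tensor 0 by rewrite !piE.
by apply/eqP/pi_tensor_eq; rewrite subr0; apply: TensorRelDr.
Qed.

Lemma tensA m (r : R) c : tens ((r : R^c) *: m) c = tens m (r *: c).
Proof. by apply/pi_tensor_eq/TensorRelA. Qed.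

End Tensor.

Section TensorMap.

Variables (R : pzRingType) (C : lmodType R) (M N : lmodType R^c).
Variable f : {linear M -> N}.

Definition freeg_map : {freeg (M * C) / int} -> {freeg (N * C) / int} :=
  fglift (fun mc => << (f mc.1, mc.2) >>).

Definition tensor_map (t : tensor M C) : tensor N C :=
  \pi_(tensor N C) (freeg_map (repr t)).

Lemma freeg_mapB x y : freeg_map (x - y) = freeg_map x - freeg_map y.
Proof. exact: lift_is_additive. Qed.

Lemma freeg_mapU m c : freeg_map << (m, c) >> = << (f m, c) >>.
Proof. by rewrite /freeg_map liftU scale1r. Qed.

Lemma tensor_rel_map x : tensor_rel x -> tensor_rel (freeg_map x).
Proof.
elim=> {x} [|x y _ relx _ rely|m m' c|m c c'|m r c].
- by rewrite -(subrr 0) freeg_mapB subrr; apply: TensorRel0.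
- by rewrite freeg_mapB; apply: TensorRelB.
- by rewrite !freeg_mapB !freeg_mapU linearD; apply: TensorRelDl.
- by rewrite !freeg_mapB !freeg_mapU; apply: TensorRelDr.
- by rewrite !freeg_mapB !freeg_mapU linearZ; apply: TensorRelA.
Qed.

Lemma tensor_map_pi x :
  tensor_map (\pi_(tensor M C) x) = \pi_(tensor N C) (freeg_map x).
Proof.
apply/pi_tensor_eq; rewrite -freeg_mapB; apply: tensor_rel_map.
by apply/pi_tensor_eq; rewrite reprK.
Qed.

Lemma tensor_map_tens m c : tensor_map (tens m c) = tens (f m) c.
Proof. by rewrite tensor_map_pi freeg_mapU. Qed.

Fact tensor_map_is_zmod_morphism : zmod_morphism tensor_map.
Proof.
move=> s t; rewrite -[s]reprK -[t]reprK -pi_tensorB !tensor_map_pi.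
by rewrite freeg_mapB pi_tensorB.
Qed.

HB.instance Definition _ :=
  GRing.isZmodMorphism.Build (tensor M C) (tensor N C) tensor_map
    tensor_map_is_zmod_morphism.

End TensorMap.

Arguments tensor_map {R} C {M N} f.

Definition flat (R : pzRingType) (C : lmodType R) : Prop :=
  forall (M N : lmodType R^c) (f : {linear M -> N}),
    injective f -> injective (tensor_map C f).

Section Induced.

Variables (gT : finGroupType) (U : {set gT}) (L : fieldType).

Definition left_inv : {pred {ffun gT -> L^o}} :=
  fun f => [forall u in U, [forall g, f (u * g)%g == f g]].

Lemma left_invP (f : {ffun gT -> L^o}) :
  reflect (forall u g, u \in U -> f (u * g)%g = f g) (f \in left_inv).
Proof.
apply: (iffP forall_inP) => [fU u g /fU /forallP/(_ g)/eqP //|fU u uU].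
by apply/forallP=> g; rewrite fU.
Qed.

Fact left_inv_submod_closed : submod_closed left_inv.
Proof.
split=> [|a f f' /left_invP fU /left_invP f'U]; apply/left_invP=> u g uU.
  by rewrite !ffunE.
by rewrite !ffunE fU // f'U.
Qed.

HB.instance Definition _ :=
  GRing.isSubmodClosed.Build L {ffun gT -> L^o} left_inv
    left_inv_submod_closed.

(* Function model of Ind_U^gT 1, on which gT acts through rtrans below. *)
Record induced := Induced {
  induced_val :> {ffun gT -> L^o};
  _ : induced_val \in left_inv
}.

HB.instance Definition _ := [isSub for induced_val].
HB.instance Definition _ := [Choice of induced by <:].
HB.instance Definition _ := [SubChoice_isSubLmodule of induced by <:].

Fact rtrans_subproof (g : gT) (f : induced) :
  [ffun x => induced_val f (x * g)%g] \in left_inv.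
Proof.
apply/left_invP=> u x uU; rewrite !ffunE -mulgA.
by have /left_invP-> := valP f.
Qed.

Definition rtrans (g : gT) (f : induced) : induced :=
  Induced (rtrans_subproof g f).

Lemma rtransE g f x : rtrans g f x = f (x * g)%g.
Proof. by rewrite ffunE. Qed.

Lemma rtrans1 f : rtrans 1%g f = f.
Proof. by apply/val_inj/ffunP=> x; rewrite ffunE mulg1. Qed.

Lemma rtransM g g' f : rtrans (g * g')%g f = rtrans g (rtrans g' f).
Proof. by apply/val_inj/ffunP=> x; rewrite !ffunE mulgA. Qed.

Fact rtrans_is_linear g : linear (rtrans g).
Proof. by move=> a f f'; apply/val_inj/ffunP=> x; rewrite !ffunE. Qed.

HB.instance Definition _ g :=
  GRing.isLinear.Build L induced induced *:%R (rtrans g) (rtrans_is_linear g).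

Definition equivariant (h : induced -> induced) : Prop :=
  linear h /\ forall g f, h (rtrans g f) = rtrans g (h f).

Definition is_endo : {pred induced -> induced} :=
  fun h => `[< equivariant h >].

Fact is_endo_zmod_closed : zmod_closed is_endo.
Proof.
split=> [|h h' /asboolP[hL hG] /asboolP[h'L h'G]]; apply/asboolP; split.
- by move=> a x y /=; rewrite scaler0 addr0.
- by move=> g f; rewrite linear0.
- move=> a x y; rewrite !fctE hL h'L scalerBr opprD.
  by rewrite addrACA.
- by move=> g f; rewrite !fctE hG h'G linearB.
Qed.

HB.instance Definition _ :=
  GRing.isZmodClosed.Build (induced -> induced) is_endo is_endo_zmod_closed.

Record endo := Endo {
  endo_val :> induced -> induced;
  _ : endo_val \in is_endo
}.

HB.instance Definition _ := [isSub for endo_val].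
HB.instance Definition _ := [Choice of endo by <:].
HB.instance Definition _ := [SubChoice_isSubZmodule of endo by <:].

Lemma endo_equivariant (h : endo) : equivariant h.
Proof. by apply/asboolP; exact: (valP h). Qed.

HB.instance Definition _ (h : endo) :=
  GRing.isLinear.Build L induced induced *:%R h (endo_equivariant h).1.

Lemma endo_rtrans (h : endo) g f : h (rtrans g f) = rtrans g (h f).
Proof. exact: (endo_equivariant h).2. Qed.

Lemma endoP (h h' : endo) : h =1 h' <-> h = h'.
Proof. by split=> [/funext eqh|-> //]; apply: val_inj. Qed.

Fact endo_one_subproof : (id : induced -> induced) \in is_endo.
Proof. by apply/asboolP. Qed.

Definition endo_one := Endo endo_one_subproof.

Fact endo_mul_subproof (h h' : endo) : (h \o h') \in is_endo.
Proof.
apply/asboolP; split=> [a x y|g f] /=; first by rewrite !linearP.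
by rewrite !endo_rtrans.
Qed.

Definition endo_mul (h h' : endo) := Endo (endo_mul_subproof h h').

Fact endo_mulA : associative endo_mul.
Proof. by move=> h1 h2 h3; apply/endoP. Qed.
Fact endo_mul1l : left_id endo_one endo_mul.
Proof. by move=> h; apply/endoP. Qed.
Fact endo_mul1r : right_id endo_one endo_mul.
Proof. by move=> h; apply/endoP. Qed.
Fact endo_mulDl : left_distributive endo_mul +%R.
Proof. by move=> h1 h2 h3; apply/endoP. Qed.
Fact endo_mulDr : right_distributive endo_mul +%R.
Proof. by move=> h1 h2 h3; apply/endoP => f /=; rewrite linearD. Qed.

HB.instance Definition _ :=
  GRing.Zmodule_isPzRing.Build endo
    endo_mulA endo_mul1l endo_mul1r endo_mulDl endo_mulDr.

(* A copy of induced: that type already carries its L-module structure, and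
   this one is to carry the structure of left module over endo. *)
Definition induced_endo : Type := induced.

HB.instance Definition _ := GRing.Zmodule.on induced_endo.

Definition endo_scale (h : endo) (f : induced_endo) : induced_endo := h f.

Fact endo_scaleA h h' f :
  endo_scale h (endo_scale h' f) = endo_scale (h * h') f.
Proof. by []. Qed.
Fact endo_scale1 : left_id 1 endo_scale.
Proof. by []. Qed.
Fact endo_scaleDr : right_distributive endo_scale +%R.
Proof. by move=> h f f'; rewrite /endo_scale linearD. Qed.
Fact endo_scaleDl f : {morph endo_scale^~ f : h h' / h + h'}.
Proof. by []. Qed.

HB.instance Definition _ :=
  GRing.Zmodule_isLmodule.Build endo induced_endo
    endo_scaleA endo_scale1 endo_scaleDr endo_scaleDl.

End Induced.

Definition upper_unip (k : finFieldType) : {set {'GL_2[k]}} :=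
  [set u : {'GL_2[k]} |
    [&& GLval u ord0 ord0 == 1, GLval u ord_max ord0 == 0
      & GLval u ord_max ord_max == 1]].

(* Main.v *)
From HB Require Import structures.
Require Import Defs.
From mathcomp Require Import all_boot all_order all_algebra all_fingroup all_field.
From mathcomp Require Import boolp functions ring cyclic.
From mathcomp Require Import generic_quotient ring_quotient freeg.

(** Everything is read off two operators.  A function in [C] is a function on [G]
that depends only on the determinant and on the bottom row of its argument.
The diagonal torus acts on [C] by left translations ([torus_shift]), and [tau]
replaces the value at a matrix with rows [v], [w] by the sum of the values at
the matrices with rows [w], [v + t w], for [t] in [k]: it is a Radon transform,
summing over affine lines of the plane.  These operators and the scalars span
[H] ([endo_span], by the Bruhat decomposition), and
[tau * tau = theta * tau] with [theta] in the span of the torus ([tau_tau]).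

Split [C] into weights [m] under the elements [diag(a^-1, a)], with
[0 <= m < q - 1].  In weight [0] the operator [theta] is invertible and the
block of [H] is semisimple, so nothing can go wrong there.  In weight
[0 < m < q - 1] the operator [theta] vanishes, hence so does [tau * tau], and
flatness amounts to the exactness of [tau].  There a function of weight [m] is
a homogeneous function of degree [m] of the bottom row.  Polynomials of degree
[m] are killed by [tau], because a polynomial of degree less than [q - 1] in
one variable sums to zero over [k]; the image of [tau] is spanned, for each
determinant, by the [m]-th powers of linear forms.

If [q] is not [p], then [m = p] is allowed, and [p]-th powers of linear forms
are additive functions while the polynomial [x^(p-1) y] is not: it lies in the
kernel of [tau] but not in the image.  This contradicts flatness through
the test [flat_annihilated], in [not_flat_of_lt].

If [q = p], no binomial coefficient ['C(i, j)] with [i < q] vanishes in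
characteristic [p], and a function of weight [m] killed by [tau] can be
shown to be a polynomial that [tau] reaches ([tau_exact_weight]).  To deduce
flatness, put [tau' = tau - theta].  Evaluation at a matrix gives an explicit
[H]-linear map from [C] to [H] ([dual_map]), and averaging over the torus
turns a linear map [P] with [P tau' + tau P = 1] into a finite dual basis of
the [H]-module [C] ([homotopy_flat]); a module with such a basis is projective,
hence flat ([dual_basis_flat]).  Exactness provides [P] away from weight [0],
and a closed formula provides it in weight [0] ([contraction_eps]). *)

Set Implicit Arguments.
Unset Strict Implicit.
Unset Printing Implicit Defensive.

Import GRing.Theory.
Local Open Scope ring_scope.

(** * Tensor products and flatness *)

Section TensorLift.

Local Open Scope quotient_scope.

Variables (R : pzRingType) (M : lmodType R^c) (C : lmodType R) (A : zmodType).
Variable B : M -> C -> A.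
Hypothesis BDl : forall m m' c, B (m + m') c = B m c + B m' c.
Hypothesis BDr : forall m c c', B m (c + c') = B m c + B m c'.
Hypothesis BA : forall m (r : R) c, B ((r : R^c) *: m) c = B m (r *: c).

Definition freeg_lift (x : {freeg (M * C) / int}) : zmodule A :=
  fglift (fun mc => B mc.1 mc.2 : zmodule A) x.

Lemma freeg_liftB x y : freeg_lift (x - y) = freeg_lift x - freeg_lift y.
Proof. exact: lift_is_additive. Qed.

Lemma freeg_liftU m c : freeg_lift << (m, c) >> = B m c.
Proof. by rewrite /freeg_lift liftU scale1r. Qed.

Lemma freeg_lift_rel x : tensor_rel x -> freeg_lift x = 0.
Proof.
elim=> {x} [|x y _ relx _ rely|m m' c|m c c'|m r c].
- by rewrite -(subrr 0) freeg_liftB subrr.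
- by rewrite freeg_liftB relx rely subrr.
- by rewrite !freeg_liftB !freeg_liftU BDl -addrA -opprD subrr.
- by rewrite !freeg_liftB !freeg_liftU BDr -addrA -opprD subrr.
- by rewrite freeg_liftB !freeg_liftU BA subrr.
Qed.

Definition tensor_lift (t : tensor M C) : A := freeg_lift (repr t).

Lemma tensor_lift_pi x : tensor_lift (\pi_(tensor M C) x) = freeg_lift x.
Proof.
apply/eqP; rewrite -subr_eq0; apply/eqP.
rewrite -[LHS]freeg_liftB; apply: freeg_lift_rel.
by apply/pi_tensor_eq; rewrite reprK.
Qed.

Lemma tensor_lift_tens m c : tensor_lift (tens m c) = B m c.
Proof. by rewrite tensor_lift_pi freeg_liftU. Qed.

Fact tensor_lift_is_zmod_morphism : zmod_morphism tensor_lift.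
Proof.
move=> s t; rewrite -[s]reprK -[t]reprK -pi_tensorB !tensor_lift_pi.
exact: freeg_liftB.
Qed.

HB.instance Definition _ :=
  GRing.isZmodMorphism.Build (tensor M C) A tensor_lift
    tensor_lift_is_zmod_morphism.

End TensorLift.

Section TensorGen.

Local Open Scope quotient_scope.

Variables (R : pzRingType) (M : lmodType R^c) (C : lmodType R).

Fact pi_tensor_is_zmod_morphism : zmod_morphism (\pi_(tensor M C)).
Proof. exact: pi_tensorB. Qed.

(** The group is generated by pure tensors, since integral combinations only
involve sums and differences. *)
Lemma tensor_ind (P : tensor M C -> Prop) :
  (forall s t, P s -> P t -> P (s - t)) -> (forall m c, P (tens m c)) ->
  forall t, P t.
Proof.
move=> PB Pt t; have P0 : P 0 by rewrite -(subrr (tens 0 0)); apply: PB.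
have PN s : P s -> P (- s) by move=> Ps; rewrite -sub0r; apply: PB.
have PD s s' : P s -> P s' -> P (s + s').
  by move=> Ps Ps'; rewrite -[s']opprK; apply/PB/PN.
have PMn s n : P s -> P (s *+ n).
  by move=> Ps; elim: n => [|n IHn]; rewrite ?mulr0n // mulrS; apply: PD.
pose pi : {additive {freeg (M * C) / int} -> tensor M C} :=
  HB.pack (\pi_(tensor M C))
  (GRing.isZmodMorphism.Build _ _ _ pi_tensor_is_zmod_morphism).
rewrite -[t]reprK -[repr t]freeg_sumE; rewrite -[X in P X]/(pi _) raddf_sum.
elim/big_ind: _ => // -[m c] _ ; case: (coeff _ _) => n.
  have -> : << Posz n *g (m, c) >> = << (m, c) >> *+ n.
    by rewrite freegU_muln natz.
  by rewrite raddfMn; apply/PMn/Pt.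
have -> : << Negz n *g (m, c) >> = << (m, c) >> *- n.+1.
  by rewrite NegzE -freegUN freegU_muln natz.
by rewrite raddfN raddfMn; apply/PN/PMn/Pt.
Qed.

Lemma tens0r (m : M) : tens m (0 : C) = 0.
Proof. by apply: (addrI (tens m 0)); rewrite -tensDr !addr0. Qed.

End TensorGen.

(** Each coordinate form [phi i] induces a map [n (x) x |-> n phi_i(x)] from [N
(x) C] to [N], natural in [N], and an element of the tensor product is recovered
from the images under these maps. So if an injection [f] kills a tensor after
base change, it kills all its coordinates in [M]. *)
Lemma dual_basis_flat (R : pzRingType) (C : lmodType R) (I : finType)
    (phi : I -> {linear C -> R^o}) (c : I -> C) :
  (forall x, x = \sum_i (phi i x : R) *: c i) -> flat C.
Proof.
move=> dual M N f injf.
pose B (V : lmodType R^c) i (m : V) (x : C) : V := (phi i x : R^c) *: m.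
have BDl V i m m' x : @B V i (m + m') x = B V i m x + B V i m' x.
  exact: scalerDr.
have BDr V i m x x' : @B V i m (x + x') = B V i m x + B V i m x'.
  by rewrite /B linearD scalerDl.
have BA V i m (r : R) x : @B V i ((r : R^c) *: m) x = B V i m (r *: x).
  by rewrite /B linearZ scalerA.
pose L V i := tensor_lift (@B V i).
have LB V i : zmod_morphism (L V i).
  exact: (tensor_lift_is_zmod_morphism (BDl V i) (BDr V i) (BA V i)).
have L_tens V i m x : L V i (tens m x) = (phi i x : R^c) *: m.
  exact: (tensor_lift_tens (BDl V i) (BDr V i) (BA V i)).
have LE V (t : tensor V C) : t = \sum_i tens (L V i t) (c i).
  elim/tensor_ind: t => [s t {1}-> {1}->|m x].
    rewrite -sumrB; apply: eq_bigr => i _; rewrite LB.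
    by apply/eqP; rewrite subr_eq -tensDl subrK.
  rewrite {1}[x]dual (big_morph _ (tensDr m) (tens0r _ m)).
  by apply: eq_bigr => i _; rewrite L_tens tensA.
have Lf i t : L N i (tensor_map C f t) = f (L M i t).
  elim/tensor_ind: t => [s t IHs IHt|m x].
    by rewrite raddfB !LB IHs IHt raddfB.
  by rewrite tensor_map_tens !L_tens linearZ.
move=> s t eqst; rewrite (LE M s) (LE M t); apply: eq_bigr => i _.
by congr tens; apply: injf; rewrite -!Lf eqst.
Qed.

Section PrincipalRightIdeal.

Variables (R : pzRingType) (a : R).

(** The right ideal [a R], seen in the right regular module. *)
Definition right_ideal : {pred (R^c)^o} := fun m =>
  `[< exists h : R, m = a * h :> R >].

Fact right_ideal_submod_closed : submod_closed right_ideal.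
Proof.
split=> [|r m m' /asboolP[h ->] /asboolP[h' ->]]; apply/asboolP.
  by exists 0; rewrite mulr0.
by exists (h * r + h'); rewrite mulrDr mulrA.
Qed.

HB.instance Definition _ :=
  GRing.isSubmodClosed.Build R^c (R^c)^o right_ideal right_ideal_submod_closed.

Record principal := Principal {
  principal_val :> (R^c)^o;
  _ : principal_val \in right_ideal
}.

HB.instance Definition _ := [isSub for principal_val].
HB.instance Definition _ := [Choice of principal by <:].
HB.instance Definition _ := [SubChoice_isSubLmodule of principal by <:].

Lemma principal_gen_subproof : (a : (R^c)^o) \in right_ideal.
Proof. by apply/asboolP; exists 1; rewrite mulr1. Qed.

Definition principal_gen := Principal principal_gen_subproof.

Lemma principalP (m : principal) : exists h : R, principal_val m = a * h :> R.
Proof. by apply/asboolP; apply: (valP m). Qed.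

End PrincipalRightIdeal.

(** The inclusion of the right ideal [a R] in [R] maps [a (x) x] to [1 (x) a x =
0], so flatness gives [a (x) x = 0]. The hypothesis on [b] says exactly that [(a
h, c) |-> b (h c)] is well defined on [a R], and evaluating the resulting map on
[a (x) x] gives [b x]. *)
Lemma flat_annihilated (R : pzRingType) (C : lmodType R) (a : R) (x : C)
    (A : zmodType) (b : {additive C -> A}) :
    flat C -> a *: x = 0 ->
    (forall (h : R) c, a * h = 0 -> b (h *: c) = 0) ->
  b x = 0.
Proof.
move=> flatC ax0 bJ.
pose f : {linear principal a -> (R^c)^o} := val.
have gx0 : tens (principal_gen a) x = 0.
  apply: (flatC _ _ f val_inj); rewrite tensor_map_tens raddf0.
  have -> : f (principal_gen a) = (a : R^c) *: (1 : (R^c)^o).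
    by rewrite /= /GRing.scale /= [RHS]mul1r.
  by rewrite tensA ax0 tens0r.
have [h hP] := choice (@principalP R a).
have bJ2 (h1 h2 : R) c : a * h1 = a * h2 -> b (h1 *: c) = b (h2 *: c).
  move=> e; apply/eqP; rewrite -subr_eq0 -raddfB -scalerBl bJ //.
  by rewrite mulrBr e subrr.
pose B (m : principal a) (c : C) := b (h m *: c).
have BDl m m' c : B (m + m') c = B m c + B m' c.
  by rewrite /B -raddfD -scalerDl; apply: bJ2; rewrite mulrDr -!hP.
have BDr m c c' : B m (c + c') = B m c + B m c'.
  by rewrite /B scalerDr raddfD.
have BA m (r : R) c : B ((r : R^c) *: m) c = B m (r *: c).
  by rewrite /B scalerA; apply: bJ2; rewrite -hP mulrA -hP.
have := tensor_lift_tens BDl BDr BA (principal_gen a) x.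
rewrite gx0 -[0](subrr 0) tensor_lift_is_zmod_morphism // subrr => /esym.
by rewrite /B -[x in b x = _]scale1r => <-; apply: bJ2; rewrite -hP mulr1.
Qed.

(** * Equivariant operators on an induced representation *)

Section Hecke.

Variables (gT : finGroupType) (U : {group gT}) (L : fieldType).
Local Notation C := (induced U L).
Local Notation H := (endo U L).
Implicit Types (f : C) (h : H) (x y g u : gT).

Lemma inducedP f f' : (forall g, f g = f' g) <-> f = f'.
Proof. by split=> [e|-> //]; apply/val_inj/ffunP. Qed.

Lemma inducedU f u g : u \in U -> f (u * g)%g = f g.
Proof. by apply/left_invP/(valP f). Qed.

Lemma inducedD f f' g : (f + f') g = f g + f' g.
Proof. by rewrite /= ffunE. Qed.

Lemma inducedN f g : (- f) g = - f g.
Proof. by rewrite /= ffunE. Qed.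

Lemma inducedZ a f g : (a *: f) g = a * f g.
Proof. by rewrite /= ffunE. Qed.

Lemma induced0 g : (0 : C) g = 0.
Proof. by rewrite /= ffunE. Qed.

Lemma induced_sum (I : Type) (r : seq I) (P : pred I) (F : I -> C) g :
  (\sum_(i <- r | P i) F i) g = \sum_(i <- r | P i) F i g.
Proof.
exact: (big_morph (fun f : C => f g) (fun f f' => inducedD f f' g) (induced0 g)).
Qed.

Lemma endo_sum (I : Type) (r : seq I) (P : pred I) (F : I -> H) f :
  (\sum_(i <- r | P i) F i) f = \sum_(i <- r | P i) F i f.
Proof. exact: (big_morph (fun h : H => h f)). Qed.

Lemma endoD h h' f : (h + h') f = h f + h' f. Proof. by []. Qed.
Lemma endoM h h' f : (h * h') f = h (h' f). Proof. by []. Qed.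

Lemma endo_add h f f' : h (f + f') = h f + h f'.
Proof. exact: linearD. Qed.

Lemma endo_homothety h a f : h (a *: f) = a *: h f.
Proof. exact: linearZ. Qed.

Fact homothety_subproof (a : L) : ( *:%R a : C -> C) \in @is_endo gT U L.
Proof.
apply/asboolP; split=> [b f f'|g f]; last by rewrite linearZ.
by rewrite scalerDr !scalerA mulrC.
Qed.

Definition homothety a : H := Endo (homothety_subproof a).

Lemma homothetyE a f : homothety a f = a *: f. Proof. by []. Qed.

Lemma homothety_comm a h : h * homothety a = homothety a * h.
Proof. by apply/endoP => f; rewrite !endoM !homothetyE linearZ. Qed.

Lemma homothetyD a b : homothety (a + b) = homothety a + homothety b.
Proof. by apply/endoP => f; rewrite endoD !homothetyE scalerDl. Qed.

Lemma homothetyM a b : homothety (a * b) = homothety a * homothety b.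
Proof. by apply/endoP => f; rewrite endoM !homothetyE scalerA. Qed.

Fact shift_subproof x f :
  ([ffun g => f (x * g)%g *+ (x \in 'N(U)%g)] : {ffun gT -> L^o}) \in @left_inv
    gT U L.
Proof.
apply/left_invP => u g uU; rewrite !ffunE.
have [nUx|_] := boolP (x \in _); last by rewrite !mulr0n.
by rewrite mulgA [(x * u)%g]conjgCV -mulgA (inducedU f (x * g)) ?memJ_norm
  ?groupV.
Qed.

(** The factor given by the truth value of [x \in 'N(U)] makes the operator
total in [x]. *)
Definition shift_fun x f : C := Induced (shift_subproof x f).

Fact shift_fun_subproof x : shift_fun x \in @is_endo gT U L.
Proof.
apply/asboolP; split=> [a f f'|y f]; apply/inducedP => g.
  by rewrite inducedD inducedZ !ffunE mulrnDl mulrnAr.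
by rewrite !ffunE mulgA.
Qed.

Definition shift x : H := Endo (shift_fun_subproof x).

Lemma shiftE x f g : x \in 'N(U)%g -> shift x f g = f (x * g)%g.
Proof. by move=> nUx; rewrite ffunE nUx. Qed.

Lemma shift1 : shift 1 = 1.
Proof. by apply/endoP => f; apply/inducedP => g; rewrite shiftE ?mul1g. Qed.

Lemma shiftM x y :
  x \in 'N(U)%g -> y \in 'N(U)%g -> shift x * shift y = shift (y * x).
Proof.
move=> nUx nUy; apply/endoP => f; apply/inducedP => g.
by rewrite endoM !shiftE ?groupM // mulgA.
Qed.

Fact coset_sum_subproof x f :
  ([ffun g => \sum_(u in U) f (x * u * g)%g] : {ffun gT -> L^o}) \in @left_inv
    gT U L.
Proof.
apply/left_invP => u g uU; rewrite !ffunE [RHS](reindex_inj (mulIg u)) /=.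
by apply: eq_big => [v|v _]; rewrite ?groupMr // !mulgA.
Qed.

Definition coset_sum_fun x f : C := Induced (coset_sum_subproof x f).

Fact coset_sum_fun_subproof x : coset_sum_fun x \in @is_endo gT U L.
Proof.
apply/asboolP; split=> [a f f'|y f]; apply/inducedP => g.
  rewrite inducedD inducedZ !ffunE mulr_sumr -big_split /=.
  by apply: eq_bigr => u _; rewrite !ffunE.
by rewrite !ffunE; apply: eq_bigr => u _; rewrite ffunE mulgA.
Qed.

(** The Hecke operator of the double coset [U x U], up to a multiplicity equal
to the order of [U :&: U :^ x]. *)
Definition coset_sum x : H := Endo (coset_sum_fun_subproof x).

Lemma coset_sumE x f g : coset_sum x f g = \sum_(u in U) f (x * u * g)%g.
Proof. by rewrite ffunE. Qed.

Lemma shift_coset_sum x t : t \in 'N(U)%g -> (x * t * x^-1)%g \in 'N(U)%g ->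
  shift t * coset_sum x = coset_sum x * shift (x * t * x^-1).
Proof.
move=> nUt nUt'; apply/endoP => f; apply/inducedP => g.
rewrite endoM [in RHS]endoM shiftE // !coset_sumE.
rewrite [RHS](reindex_inj (conjg_inj t)) /=.
apply: eq_big => [u|u _]; first by rewrite memJ_norm.
rewrite shiftE // /conjg !mulgA; congr (f (_ * g)%g).
by rewrite !(mulgKV, mulgK).
Qed.

Fact delta_subproof :
  ([ffun g => (g \in U)%:R] : {ffun gT -> L^o}) \in @left_inv gT U L.
Proof. by apply/left_invP => u g uU; rewrite !ffunE groupMl. Qed.

(** The indicator of [U], which generates [C] as a representation. *)
Definition delta : C := Induced delta_subproof.

Lemma deltaE g : delta g = (g \in U)%:R. Proof. by rewrite ffunE. Qed.

Lemma induced_delta f :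
  f = \sum_(A in rcosets U setT) (f (fingroup.repr A) : L) *: rtrans
    (fingroup.repr A)^-1 delta.
Proof.
apply/inducedP => g; rewrite induced_sum.
have gU : (U :* g)%g \in rcosets U setT by rewrite -rcosetE imset_f ?inE.
rewrite (bigD1 _ gU) big1 ?addr0 => [|A /andP[/imsetP[y _ ->] neq]].
  rewrite inducedZ rtransE deltaE -mem_rcoset rcoset_repr rcoset_refl mulr1.
  by case: repr_rcosetP => u uU; rewrite inducedU // [RHS]addr0.
rewrite inducedZ rtransE deltaE rcosetE -mem_rcoset rcoset_repr.
have [gUy|_] := boolP (_ \in _); last by rewrite mulr0.
by case/eqP: neq; rewrite rcosetE; apply/esym/rcoset_eqP.
Qed.

Lemma endo_delta h f g :
  h f g = \sum_(A in rcosets U setT) f (fingroup.repr A) * h delta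
    (g * (fingroup.repr A)^-1)%g.
Proof.
rewrite {1}[f]induced_delta linear_sum induced_sum; apply: eq_bigr => A _.
by rewrite linearZ -[in RHS]rtransE -endo_rtrans -inducedZ.
Qed.

(** An endomorphism is determined by its value on the cyclic generator [delta],
so that [H] embeds in the functions on [G] that are invariant under [U] on both
sides. *)
Lemma endo_delta_inj h h' : h delta = h' delta -> h = h'.
Proof.
by move=> e; apply/endoP => f; apply/inducedP => g; rewrite !endo_delta e.
Qed.

Lemma endo_deltaU h g u : u \in U -> h delta (g * u)%g = h delta g.
Proof.
move=> uU; rewrite -rtransE -endo_rtrans; congr (h _ g).
by apply/inducedP => y; rewrite rtransE !deltaE groupMr.
Qed.

End Hecke.

(** * Matrices of size two by their entries *)

Section GL2.

Variable k : finFieldType.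
Local Notation G := {'GL_2[k]}.
Implicit Types (a b c d s t x y : k) (g : G).

Definition mx2 a b c d : 'M[k]_2 :=
  \matrix_(i, j) if i == ord0 then if j == ord0 then a else b
                 else if j == ord0 then c else d.

Lemma det_mx2 (A : 'M[k]_2) :
  \det A = A ord0 ord0 * A ord_max ord_max - A ord0 ord_max * A ord_max ord0.
Proof.
rewrite (expand_det_row _ ord0) !big_ord_recl big_ord0 addr0.
rewrite /cofactor !det_mx11 !mxE /= expr0 expr1 mul1r mulN1r mulrN.
have -> : fintype.lift ord0 ord0 = ord_max :> 'I_2 by apply/val_inj.
by congr (_ * A _ _ - _ * A _ _); apply/val_inj.
Qed.

(** Singular matrices are sent to [1], which keeps the function total. *)
Definition gl a b c d : G := insubd (1%g : G) (mx2 a b c d).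

Lemma glK a b c d : a * d - b * c != 0 -> GLval (gl a b c d) = mx2 a b c d.
Proof.
move=> nz; rewrite /gl val_insubd.
rewrite -[_ \in _]/(mx2 a b c d \in unitmx) unitmxE det_mx2 !mxE /= unitfE.
by rewrite nz.
Qed.

Lemma mx2P (A B : 'M[k]_2) :
  A ord0 ord0 = B ord0 ord0 -> A ord0 ord_max = B ord0 ord_max ->
  A ord_max ord0 = B ord_max ord0 -> A ord_max ord_max = B ord_max ord_max ->
  A = B.
Proof.
move=> e1 e2 e3 e4; apply/matrixP=> i j.
have ord2 (l : 'I_2) : l = ord0 \/ l = ord_max.
  by case: l => [[|[|]] //] ?; [left|right]; apply/val_inj.
by case: (ord2 i) => ->; case: (ord2 j) => ->.
Qed.

Lemma gl_case g :
  exists a b c d, a * d - b * c != 0 /\ g = gl a b c d.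
Proof.
have nz : g ord0 ord0 * g ord_max ord_max - g ord0 ord_max * g ord_max ord0 != 0.
  by rewrite -det_mx2; exact: (GL_det g).
do 4!eexists; split; first exact: nz.
by apply/val_inj; rewrite /= glK //; apply: mx2P; rewrite mxE.
Qed.

Lemma gl_inj a b c d a' b' c' d' : a * d - b * c != 0 ->
  a' * d' - b' * c' != 0 ->
  gl a b c d = gl a' b' c' d' -> [/\ a = a', b = b', c = c' & d = d'].
Proof.
move=> nz nz' /(congr1 (@GLval _ _)); rewrite !glK // => /matrixP e.
have := e ord0 ord0; have := e ord0 ord_max.
by have := e ord_max ord0; have := e ord_max ord_max; rewrite !mxE.
Qed.

Lemma glM a b c d a' b' c' d' : a * d - b * c != 0 -> a' * d' - b' * c' != 0 ->
  (gl a b c d * gl a' b' c' d')%g =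
  gl (a * a' + b * c') (a * b' + b * d') (c * a' + d * c') (c * b' + d * d').
Proof.
move=> nz nz'; apply/val_inj.
rewrite -[LHS]/(GLval (gl a b c d) *m GLval (gl a' b' c' d')).
rewrite -[RHS]/(GLval _) !glK //.
  by apply: mx2P; rewrite !mxE !big_ord_recl big_ord0 !mxE /= addr0.
have -> : (a * a' + b * c') * (c * b' + d * d') -
    (a * b' + b * d') * (c * a' + d * c') =
    (a * d - b * c) * (a' * d' - b' * c') by ring.
by rewrite mulf_neq0.
Qed.

Lemma gl1 : gl 1 0 0 1 = 1%g.
Proof.
apply/val_inj; rewrite /= glK ?mul0r ?subr0 ?mulr1 ?oner_eq0 //.
by apply: mx2P; rewrite !mxE.
Qed.

Lemma upper_unipE a b c d : a * d - b * c != 0 ->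
  (gl a b c d \in upper_unip k) = [&& a == 1, c == 0 & d == 1].
Proof. by move=> nz; rewrite inE glK // !mxE. Qed.

Definition unip t := gl 1 t 0 1.
(** An involution, at the cost of having determinant [-1]. *)
Definition weyl := gl 0 1 1 0.

Lemma unip_nz t : 1 * 1 - t * 0 != 0 :> k.
Proof. by rewrite mulr0 subr0 mulr1 oner_eq0. Qed.

Lemma weyl_nz : 0 * 0 - 1 * 1 != 0 :> k.
Proof. by rewrite mulr0 sub0r mulr1 oppr_eq0 oner_eq0. Qed.

Lemma unip_in t : unip t \in upper_unip k.
Proof. by rewrite upper_unipE ?unip_nz // !eqxx. Qed.

Lemma unip_inj : injective unip.
Proof. by move=> t t' /gl_inj[] //; rewrite unip_nz. Qed.

Lemma upper_unipP u : u \in upper_unip k -> exists t, u = unip t.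
Proof.
have [a [b [c [d [nz ->]]]]] := gl_case u.
by rewrite upper_unipE // => /and3P[/eqP-> /eqP-> /eqP->]; exists b.
Qed.

Lemma unipM t t' : (unip t * unip t')%g = unip (t + t').
Proof.
rewrite glM ?unip_nz // /unip.
by congr gl; ring.
Qed.

Lemma upper_unip_group_set : group_set (upper_unip k).
Proof.
apply/group_setP; split=> [|_ _ /upper_unipP[t ->] /upper_unipP[t' ->]].
  by rewrite -gl1 unip_in.
by rewrite unipM unip_in.
Qed.

Canonical upper_unip_group := Group upper_unip_group_set.
Local Notation U := upper_unip_group.

Lemma big_upper_unip (V : nmodType) (F : G -> V) :
  \sum_(u in U) F u = \sum_t F (unip t).
Proof.
rewrite -(big_imset _ (in2W unip_inj)); apply: eq_bigl => u /=.
apply/idP/imsetP => [/upper_unipP[t ->]|[t _ ->]]; first by exists t.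
exact: unip_in.
Qed.

(** Indexing the diagonal torus by a product of groups lets sums over it be
reindexed by group translations. *)
Definition torus (z : {unit k} * {unit k}) := gl (val z.1) 0 0 (val z.2).

Lemma unit_nz (a : {unit k}) : val a != 0.
Proof. by rewrite -unitfE (valP a). Qed.

Lemma torus_nz (z : {unit k} * {unit k}) : val z.1 * val z.2 - 0 * 0 != 0.
Proof. by rewrite mulr0 subr0 mulf_neq0 ?unit_nz. Qed.

Lemma torusM z w : (torus z * torus w)%g = torus (z * w)%g.
Proof.
by rewrite glM ?torus_nz // /torus /=; congr gl; ring.
Qed.

Lemma torus1 : torus 1%g = 1%g.
Proof. by rewrite -gl1. Qed.

Lemma torusV z : (torus z)^-1%g = torus z^-1%g.
Proof. by apply: (mulgI (torus z)); rewrite mulgV torusM mulgV torus1. Qed.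

Lemma torus_gl z a b c d : a * d - b * c != 0 ->
  (torus z * gl a b c d)%g =
  gl (val z.1 * a) (val z.1 * b) (val z.2 * c) (val z.2 * d).
Proof.
by move=> nz; rewrite glM ?torus_nz //; congr gl; rewrite mul0r ?addr0 ?add0r.
Qed.

Lemma torus_norm z : torus z \in 'N(upper_unip k)%g.
Proof.
rewrite inE; apply/subsetP => _ /imsetP[_ /upper_unipP[t ->] ->].
rewrite /conjg torusV /unip glM ?unip_nz ?torus_nz // torus_gl; last first.
  rewrite !(mul0r, mulr0, mul1r, mulr1, add0r, addr0, subr0).
  by rewrite mulf_neq0 ?unit_nz.
set t' := (X in gl _ X _ _).
rewrite (_ : gl _ _ _ _ = unip t') ?unip_in // /unip; congr gl.
- by rewrite !(mul0r, mulr0, mul1r, mulr1, add0r, addr0, subr0) mulVf ?unit_nz.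
- by rewrite !(mul0r, mulr0, mul1r, mulr1, add0r, addr0, subr0).
- by rewrite !(mul0r, mulr0, mul1r, mulr1, add0r, addr0, subr0) mulVf ?unit_nz.
Qed.

Definition swap (z : {unit k} * {unit k}) := (z.2, z.1).

Lemma weyl_gl a b c d : a * d - b * c != 0 -> (weyl * gl a b c d)%g = gl c d a b.
Proof.
move=> nz; rewrite glM ?weyl_nz //.
by congr gl; rewrite mul0r mul1r ?addr0 ?add0r.
Qed.

Lemma weylV : weyl^-1%g = weyl.
Proof.
by apply: (mulgI weyl); rewrite mulgV (weyl_gl weyl_nz) gl1.
Qed.

Lemma torus_conj_weyl z : (weyl * torus z * weyl^-1)%g = torus (swap z).
Proof.
rewrite weylV weyl_gl ?torus_nz // glM ?weyl_nz //; last first.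
  by rewrite mulr0 sub0r oppr_eq0 mulf_neq0 ?unit_nz.
by congr gl; rewrite !(mul0r, mulr0, mul1r, mulr1, add0r, addr0, subr0).
Qed.

End GL2.

(** * The operator tau and the torus *)

Section HeckeGL2.

Variables (k : finFieldType) (L : fieldType).
Local Notation U := (upper_unip_group k).
Local Notation C := (induced U L).
Local Notation H := (endo U L).
Local Notation T := ({unit k} * {unit k})%type.
Implicit Types (f : C) (h : H) (a b c d t s : k) (z w : T).

Lemma big_unit (V : nmodType) (F : k -> V) :
  \sum_(s | s != 0) F s = \sum_(a : {unit k}) F (val a).
Proof.
rewrite -(big_imset _ (in2W val_inj)); apply: eq_bigl => s /=.
apply/idP/imsetP => [nz|[a _ ->]]; last exact: unit_nz.
by exists (finField_unit nz).
Qed.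

Lemma inducedU_gl f t a b c d : a * d - b * c != 0 ->
  f (gl (a + t * c) (b + t * d) c d) = f (gl a b c d).
Proof.
move=> nz; rewrite -(inducedU f (gl a b c d) (unip_in t)) glM ?unip_nz //.
by congr (f (gl _ _ _ _)); ring.
Qed.

Lemma induced_glP f f' :
  (forall a b c d, a * d - b * c != 0 -> f (gl a b c d) = f' (gl a b c d)) ->
  f = f'.
Proof.
move=> e; apply/inducedP => g.
by have [a [b [c [d [nz ->]]]]] := gl_case g; apply: e.
Qed.

Definition tau : H := coset_sum U L (weyl k).
Definition torus_shift z : H := shift U L (torus z).
Local Notation S := torus_shift.

Lemma tauE f a b c d : a * d - b * c != 0 ->
  tau f (gl a b c d) = \sum_t f (gl c d (a + t * c) (b + t * d)).
Proof.
move=> nz; rewrite coset_sumE big_upper_unip; apply: eq_bigr => t _.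
rewrite -mulgA glM ?unip_nz // weyl_gl.
  by congr (f (gl _ _ _ _)); ring.
by rewrite [X in X != 0](_ : _ = a * d - b * c) //; ring.
Qed.

Lemma torus_shiftE f z a b c d : a * d - b * c != 0 ->
  S z f (gl a b c d) =
  f (gl (val z.1 * a) (val z.1 * b) (val z.2 * c) (val z.2 * d)).
Proof. by move=> nz; rewrite shiftE ?torus_norm // torus_gl. Qed.

Lemma torus_shiftM z w : S z * S w = S (z * w)%g.
Proof.
rewrite /S shiftM ?torus_norm // torusM; congr (shift _ _ (torus _)).
by congr pair; apply/val_inj; rewrite /= mulrC.
Qed.

Lemma torus_shift1 : S 1%g = 1.
Proof. by rewrite /S torus1 shift1. Qed.

Lemma torus_shift_tau z : S z * tau = tau * S (swap z).
Proof.
by rewrite /S /tau shift_coset_sum ?torus_conj_weyl // torus_norm.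
Qed.

Definition unit_opp (a : {unit k}) : {unit k} :=
  (FinRing.unit k (unitrN1 k) * a)%g.

Lemma unit_oppE (a : {unit k}) : val (unit_opp a) = - val a.
Proof. by rewrite /= mulN1r. Qed.

Lemma unit_opp_inj : injective unit_opp.
Proof. exact: mulgI. Qed.

(** The matrices [diag(- a^-1, a)] are the torus parts in the Bruhat
decomposition of [weyl * unip a * weyl]. *)
Definition theta : H := \sum_(a : {unit k}) S (unit_opp a^-1%g, a).

Lemma detM z a b c d : a * d - b * c != 0 ->
  (val z.1 * a) * (val z.2 * d) - (val z.1 * b) * (val z.2 * c) != 0.
Proof.
move=> nz; rewrite [X in X != 0](_ : _ = val z.1 * val z.2 * (a * d - b * c)).
  by rewrite !mulf_neq0 // unit_nz.
by ring.
Qed.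

(** The determinant of the matrices in [tauE]. *)
Lemma tau_sum_nz t a b c d : a * d - b * c != 0 ->
  c * (b + t * d) - d * (a + t * c) != 0.
Proof.
move=> nz; rewrite [X in X != 0](_ : _ = - (a * d - b * c)) ?oppr_eq0 //; by ring.
Qed.

(** The square of [tau] is a sum over [s] and [t] of values at matrices whose
bottom row is [w + s (v + t w)], [v] and [w] being the rows of the argument. The
terms with [s = 0] do not depend on [t] and add up to a multiple of [q]. For [s
!= 0], adding [-1 / s] times the bottom row to the top row brings the matrix to
the shape occurring in [theta (tau f)] at the unit [-1 / s]. *)
Lemma tau_tau : #|k|%:R = 0 :> L -> tau * tau = theta * tau.
Proof.
move=> q0; apply/endoP => f; apply: induced_glP => a b c d nz.
rewrite !endoM endo_sum induced_sum tauE //.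
under [RHS]eq_bigr => e _ do rewrite torus_shiftE // (tauE f (detM _ nz)).
under [LHS]eq_bigr => t _ do rewrite (tauE f (tau_sum_nz t nz)).
rewrite exchange_big /= (bigD1 0) //= big_unit.
rewrite [X in X + _](_ : _ = 0) ?add0r; last first.
  under eq_bigr => t _ do rewrite !mul0r !addr0 inducedU_gl //.
  by rewrite sumr_const -mulr_natr q0 mulr0.
(* From now on [s = -1 / e]. *)
rewrite (reindex_inj unit_opp_inj) (reindex_inj invg_inj) /=.
apply: eq_bigr => e _.
pose v := FinRing.uval e; have nv : v != 0 := unit_nz e.
rewrite -/v !mulN1r.
have affine_inj : injective (fun t : k => v^-1 * (1 - t * v^-1)).
  move=> t t' /(mulfI (invr_neq0 nv))/addrI/oppr_inj.
  exact: (mulIf (invr_neq0 nv)).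
rewrite [RHS](reindex_inj affine_inj) /=; apply: eq_bigr => t _.
rewrite -(inducedU_gl f v); last first.
  rewrite [X in X != 0](_ : _ = a * d - b * c) //; by ring.
by congr (f (gl _ _ _ _)); field.
Qed.

Lemma tau_torus_shift z : tau * S z = S (swap z) * tau.
Proof. by rewrite torus_shift_tau; case: z. Qed.

Lemma unit_opp_invK (e : {unit k}) : unit_opp (unit_opp e^-1)^-1 = e.
Proof. by apply/val_inj; rewrite !unit_oppE /= mulN1r invrN invrK opprK. Qed.

End HeckeGL2.

(** * A spanning set of the Hecke algebra and the maps from C to it *)

Section Span.

Variables (k : finFieldType) (L : fieldType).
Local Notation U := (upper_unip_group k).
Local Notation C := (induced U L).
Local Notation H := (endo U L).
Local Notation T := ({unit k} * {unit k})%type.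
Local Notation tau := (tau k L).
Local Notation S := (@torus_shift k L).
Local Notation theta := (theta k L).
Local Notation hom := (@homothety _ U L).
Local Notation delta := (delta U L).
Implicit Types (f : C) (h : H) (a b c d t s : k) (z w : T).

(** By the Bruhat decomposition, [G] is covered by the double cosets of the
diagonal and of the antidiagonal matrices. *)
Lemma biinvariant_eq f f' :
  (forall g u, u \in U -> f (g * u)%g = f g) ->
  (forall g u, u \in U -> f' (g * u)%g = f' g) ->
  (forall z, f (torus z) = f' (torus z)) ->
  (forall z, f (gl 0 (val z.1) (val z.2) 0) = f' (gl 0 (val z.1) (val z.2) 0)) ->
  f = f'.
Proof.
move=> fU f'U eqT eqW; apply: induced_glP => a b c d nz.
have [c0|cn0] := eqVneq c 0.
  rewrite c0 mulr0 subr0 in nz; have := nz; rewrite mulf_eq0 negb_or.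
  case/andP=> an0 dn0.
  have nz' : a * d - b * 0 != 0 by rewrite mulr0 subr0.
  rewrite c0 -(inducedU_gl f (- b / d) nz') -(inducedU_gl f' (- b / d) nz').
  rewrite mulr0 addr0 mulfVK // subrr.
  exact: (eqT (finField_unit an0, finField_unit dn0)).
rewrite -(fU _ _ (unip_in (- d / c))) -(f'U _ _ (unip_in (- d / c))).
rewrite glM ?unip_nz // !(mulr0, mulr1, addr0).
have -> : c * (- d / c) + d = 0 by field.
set b' := _ + b; have nz' : a * 0 - b' * c != 0.
  rewrite [X in X != 0](_ : _ = a * d - b * c) // /b'; by field.
rewrite -(inducedU_gl f (- a / c) nz') -(inducedU_gl f' (- a / c) nz').
rewrite mulr0 addr0 mulfVK // subrr.
have bn0 : b' != 0 by apply: contraNneq nz' => ->; rewrite mulr0 mul0r subrr.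
exact: (eqW (finField_unit bn0, finField_unit cn0)).
Qed.

Lemma delta_gl a b c d : a * d - b * c != 0 ->
  delta (gl a b c d) = [&& a == 1, c == 0 & d == 1]%:R.
Proof. by move=> nz; rewrite deltaE upper_unipE. Qed.

Lemma antitorus_nz z : 0 * 0 - val z.1 * val z.2 != 0.
Proof. by rewrite mulr0 sub0r oppr_eq0 mulf_neq0 ?unit_nz. Qed.

Lemma unit_divE (e e' : {unit k}) : (val e^-1%g * val e' == 1) = (e == e').
Proof.
by rewrite -[X in X == _]/(val (e^-1 * e')%g) -[1]/(val (1 : {unit k})%g)
   (inj_eq val_inj) -eq_mulVg1.
Qed.

Lemma torus_shift_delta z w : S z^-1%g delta (torus w) = (z == w)%:R.
Proof.
have nz := torus_nz w; have nz' := detM z^-1%g nz.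
rewrite torus_shiftE // delta_gl // mulr0 eqxx /= !unit_divE.
by case: z {nz'} => z1 z2; case: w {nz} => w1 w2.
Qed.

Lemma torus_shift_delta_anti z w : S z^-1%g delta (gl 0 (val w.1) (val w.2) 0) =
  0.
Proof.
have nz := antitorus_nz w; have nz' := detM z^-1%g nz.
by rewrite torus_shiftE // delta_gl // mulr0 eq_sym oner_eq0.
Qed.

Lemma torus_shift_tau_delta z w : S z^-1%g (tau delta) (torus w) = 0.
Proof.
have nz := torus_nz w; have nz' := detM z^-1%g nz.
rewrite torus_shiftE // (tauE _ nz') big1 // => t _.
by rewrite (delta_gl (tau_sum_nz t nz')) mulr0 eq_sym oner_eq0.
Qed.

Lemma torus_shift_tau_delta_anti z w :
  S z^-1%g (tau delta) (gl 0 (val w.1) (val w.2) 0) = (z == w)%:R.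
Proof.
have nz := antitorus_nz w; have nz' := detM z^-1%g nz.
rewrite torus_shiftE // (tauE _ nz') (bigD1 0) // big1 => [|t tn0].
  rewrite (delta_gl (tau_sum_nz 0 nz')) !mulr0 !mul0r !addr0 eqxx /=.
  rewrite !unit_divE [LHS]addr0; congr (_ %:R).
  by case: z {nz'} => z1 z2; case: w {nz} => w1 w2; rewrite andbC.
rewrite (delta_gl (tau_sum_nz t nz')) mulr0 add0r !mulf_eq0.
by rewrite (negPf tn0) !(negPf (unit_nz _)) andbF.
Qed.

(** Both sides are determined by the biinvariant function that they produce from
[delta]. The translate [S z^-1 delta] is the indicator of one coset of diagonal
type, and [S z^-1 (tau delta)] that of one double coset of antidiagonal type. *)
Lemma endo_span h :
  h = \sum_z (hom (h delta (torus z)) * S z^-1%g +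
      hom (h delta (gl 0 (val z.1) (val z.2) 0)) * (S z^-1%g * tau)).
Proof.
apply: endo_delta_inj; apply: biinvariant_eq => [g u|g u|w|w].
- exact: endo_deltaU.
- exact: endo_deltaU.
- rewrite endo_sum induced_sum (bigD1 w) // big1 => [|z zw].
    rewrite endoD inducedD !endoM !homothetyE !inducedZ torus_shift_tau_delta
      torus_shift_delta.
    by rewrite eqxx mulr0 mulr1 addr0 [RHS]addr0.
  rewrite endoD inducedD !endoM !homothetyE !inducedZ torus_shift_tau_delta
    torus_shift_delta.
  by rewrite (negPf zw) !mulr0 addr0.
- rewrite endo_sum induced_sum (bigD1 w) // big1 => [|z zw].
    rewrite endoD inducedD !endoM !homothetyE !inducedZ.
    by rewrite torus_shift_tau_delta_anti torus_shift_delta_anti eqxx mulr0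
      mulr1 add0r [RHS]addr0.
  rewrite endoD inducedD !endoM !homothetyE !inducedZ.
  by rewrite torus_shift_tau_delta_anti torus_shift_delta_anti (negPf zw) !mulr0
    addr0.
Qed.

(** The complementary factor: [tau' * tau = 0], although [tau] need not square
to zero. *)
Definition tau' : H := tau - theta.

Lemma tauB f : tau f = tau' f + theta f.
Proof. by rewrite -endoD subrK. Qed.

Hypothesis q0 : #|k|%:R = 0 :> L.

Lemma tau'_tau : tau' * tau = 0.
Proof. by rewrite mulrBl tau_tau // subrr. Qed.

Lemma swapM z w : swap (z * w)%g = (swap z * swap w)%g.
Proof. by []. Qed.

(** The [H]-linear form on [C] attached to evaluation at [g]. The shape is
forced: writing a linear form with values in [H] on the basis of the [S z] and
the [S z * tau], compatibility with the torus leaves two unknown linear forms,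
and compatibility with [tau] expresses the first as the second composed with
[tau']. *)
Definition dual_map g f : H :=
  \sum_z (hom (tau' (S z^-1%g f) g) * S z +
          hom (S z^-1%g f g) * (S z * tau)).

Lemma homothety_addrACA (r r' t t' : L) h h' :
  hom (r + r') * h + hom (t + t') * h' =
  (hom r * h + hom t * h') + (hom r' * h + hom t' * h').
Proof. by rewrite !homothetyD !mulrDl addrACA. Qed.

Lemma dual_mapD g f f' : dual_map g (f + f') = dual_map g f + dual_map g f'.
Proof.
rewrite /dual_map -big_split; apply: eq_bigr => z _.
rewrite endo_add inducedD endo_add inducedD; exact: homothety_addrACA.
Qed.

Lemma dual_mapZ g (a : L) f : dual_map g (hom a f) = hom a * dual_map g f.
Proof.
rewrite /dual_map mulr_sumr; apply: eq_bigr => z _.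
rewrite mulrDr !mulrA -!homothetyM -!inducedZ -!homothetyE -!endoM.
by rewrite -!mulrA -!homothety_comm !mulrA.
Qed.

Lemma dual_map_torus_shift g w f : dual_map g (S w f) = S w * dual_map g f.
Proof.
rewrite /dual_map mulr_sumr (reindex_inj (mulgI w)); apply: eq_bigr => z _.
have e : S (w * z)^-1%g (S w f) = S z^-1%g f.
  by rewrite -endoM torus_shiftM invMg mulgKV.
by rewrite e -torus_shiftM mulrDr !mulrA -!homothety_comm.
Qed.

Lemma swapK : involutive (@swap k).
Proof. by case. Qed.

Lemma homothety_suml (I : Type) (r : seq I) (F : I -> L) :
  hom (\sum_(i <- r) F i) = \sum_(i <- r) hom (F i).
Proof.
apply: (big_morph hom) => [a b|]; first exact: homothetyD.
by apply/endoP => f; rewrite homothetyE scale0r.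
Qed.

(** The coefficients on the [S z] vanish since [tau' * tau = 0]. On the [S z *
tau], substituting [tau = tau' + theta] on the left matches the terms in [tau']
with [tau * S z], and the terms in [theta] with [tau * (S z * tau)]; the last
match rests on the invariance of [theta] under the exchange of the two diagonal
entries. *)
Lemma dual_map_tau g f : dual_map g (tau f) = tau * dual_map g f.
Proof.
have Dt z : tau' (S z^-1%g (tau f)) = 0.
  by rewrite -(endoM (S _)) torus_shift_tau -!endoM mulrA tau'_tau mul0r.
have St z : S z^-1%g (tau f) = tau' (S (swap z)^-1%g f) + theta
  (S (swap z)^-1%g f).
  by rewrite -tauB -endoM torus_shift_tau.
rewrite /dual_map mulr_sumr [RHS](reindex_inj (inv_inj swapK)).
transitivity (\sum_z (hom (tau' (S (swap z)^-1%g f) g) * (S z * tau) +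
   hom (theta (S (swap z)^-1%g f) g) * (S z * tau))).
  apply: eq_bigr => z _; rewrite Dt St inducedD homothetyD mulrDl.
  rewrite (_ : hom _ = 0) ?mul0r ?add0r //.
  by apply/endoP => f'; rewrite homothetyE induced0 scale0r.
transitivity (\sum_z (hom (tau' (S (swap z)^-1%g f) g) * (S z * tau) +
   hom (S (swap z)^-1%g f g) * (S z * theta * tau))); last first.
  apply: eq_bigr => z _; rewrite mulrDr !mulrA !homothety_comm -!mulrA.
  by rewrite tau_torus_shift swapK [tau * _]mulrA tau_torus_shift swapK -!mulrA
    tau_tau // !mulrA.
rewrite !big_split; congr (_ + _).
transitivity ((\sum_z hom (theta (S (swap z)^-1%g f) g) * S z) * tau).
  by rewrite mulr_suml; apply: eq_bigr => z _; rewrite mulrA.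
transitivity ((\sum_z hom (S (swap z)^-1%g f g) * (S z * theta)) * tau);
  last by rewrite mulr_suml; apply: eq_bigr => z _; rewrite !mulrA.
congr (_ * tau).
pose y (e : {unit k}) : T := (unit_opp e^-1%g, e).
transitivity (\sum_z \sum_e hom (S (y e) (S (swap z)^-1%g f) g) * S z).
  apply: eq_bigr => z _.
  by rewrite endo_sum induced_sum homothety_suml mulr_suml.
transitivity (\sum_z \sum_e hom (S (swap z)^-1%g f g) * (S z * S (y e)));
  last by apply: eq_bigr => z _; rewrite -mulr_sumr -mulr_sumr.
rewrite exchange_big [RHS]exchange_big (reindex_inj (@unit_opp_inj k)).
rewrite (reindex_inj invg_inj); apply: eq_bigr => e _.
rewrite (reindex_inj (mulIg (y e))); apply: eq_bigr => z _.
have y_swap : y (unit_opp e^-1)%g = swap (y e) by rewrite /y unit_opp_invK.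
by rewrite y_swap -endoM [in RHS]torus_shiftM torus_shiftM
  [X in S X f](_ : _ = (swap z)^-1%g) // swapM invMg mulKVg.
Qed.

Lemma dual_map_linear g : linear (dual_map g : induced_endo U L -> H^o).
Proof.
have dual_mapM h f : dual_map g (h f) = h * dual_map g f.
  rewrite {1 2}[h]endo_span endo_sum mulr_suml.
  have dual_map0 : dual_map g 0 = 0.
    by apply: (addrI (dual_map g 0)); rewrite -dual_mapD !addr0.
  rewrite (big_morph (dual_map g) (dual_mapD g) dual_map0); apply: eq_bigr => z _.
  by rewrite endoD dual_mapD !endoM !dual_mapZ !dual_map_torus_shift
    dual_map_tau mulrDl !mulrA.
by move=> h f f'; rewrite dual_mapD; congr (_ + _); exact: dual_mapM.
Qed.

End Span.

Section Homotopy.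

Variables (k : finFieldType) (L : fieldType).
Local Notation U := (upper_unip_group k).
Local Notation C := (induced U L).
Local Notation H := (endo U L).
Local Notation T := ({unit k} * {unit k})%type.
Local Notation tau := (tau k L).
Local Notation tau' := (tau' k L).
Local Notation S := (@torus_shift k L).
Local Notation delta := (delta U L).
Hypothesis q0 : #|k|%:R = 0 :> L.

Lemma card_unit_natr : #|{: {unit k}}|%:R = - 1 :> L.
Proof.
rewrite -cardsT card_finField_unit; apply/eqP; rewrite -addr_eq0 -mulrSr.
by rewrite prednK ?q0 // (cardD1 0).
Qed.

(** The order [(q - 1)^2] of the torus is [1] in characteristic [p], so that
averages over the torus need no denominator. *)
Lemma card_torus_natr : #|{: T}|%:R = 1 :> L.
Proof. by rewrite card_prod natrM card_unit_natr mulrNN mulr1. Qed.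

(** The dual basis pairs evaluation at a representative of each coset with the
image under [P] of the indicator of that coset. Its reconstruction formula
unfolds to the sum over the torus of the conjugates of [P tau' + tau P], which
counts the identity [(q - 1)^2 = 1] times. *)
Lemma homotopy_flat (P : {linear C -> C}) :
  (forall f, P (tau' f) + tau (P f) = f) ->
  flat (induced_endo (upper_unip k) L : lmodType (endo (upper_unip k) L)).
Proof.
move=> htpy.
pose lphi (A : {set {'GL_2[k]}}) : {linear induced_endo U L -> H^o} :=
  HB.pack (dual_map (fingroup.repr A) : induced_endo U L -> H^o)
   (GRing.isLinear.Build _ _ _ _ _ (dual_map_linear q0 (fingroup.repr A))).
pose e (A : {set {'GL_2[k]}}) : induced_endo U L :=
  P (if A \in rcosets U setT then rtrans (fingroup.repr A)^-1 delta else 0).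
apply: (@dual_basis_flat H (induced_endo U L) _ lphi e) => f.
have Pf (f' : C) : P f' = \sum_A homothety U (f' (fingroup.repr A) : L) (e A).
  rewrite {1}(induced_delta f') linear_sum big_mkcond; apply: eq_bigr => A _.
  rewrite homothetyE /e; case: ifP => _; first by rewrite linearZ.
  by rewrite linear0 scaler0.
transitivity (\sum_z S z (P (tau' (S z^-1%g f)) + tau (P (S z^-1%g f)))).
  transitivity (\sum_(z : T) (f : C)).
    by rewrite sumr_const -scaler_nat card_torus_natr scale1r.
  by apply: eq_bigr => z _; rewrite htpy -endoM torus_shiftM mulgV torus_shift1.
transitivity (\sum_A \sum_z
   (S z (homothety U (tau' (S z^-1%g f) (fingroup.repr A) : L) (e A)) +
   S z (tau (homothety U (S z^-1%g f (fingroup.repr A) : L) (e A))))).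
  rewrite exchange_big; apply: eq_bigr => z _.
  by rewrite endo_add !Pf !linear_sum -big_split.
apply: eq_bigr => A _; rewrite -[RHS]/(dual_map (fingroup.repr A) f (e A)).
rewrite endo_sum; apply: eq_bigr => z _.
by rewrite endoD !homothetyE !endo_homothety.
Qed.

End Homotopy.

(** * Power sums over a finite field *)

Section PowerSums.

Variables (k : finFieldType) (L : fieldType) (iota : {rmorphism k -> L}).
Local Notation N := (#|k|.-1).

Lemma card_natr0 : #|k|%:R = 0 :> L.
Proof.
rewrite -(rmorph_nat iota) -[RHS](rmorph0 iota); congr (iota _).
apply/eqP; rewrite -FinRing.zmodXgE -[_ == _]order_dvdn -cardsT.
by rewrite order_dvdG ?inE.
Qed.

Lemma card_predK : N.+1 = #|k|.
Proof. by rewrite prednK // (cardD1 0). Qed.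

Lemma expf_pred_card (x : k) : x != 0 -> x ^+ N = 1.
Proof.
by move=> x0; apply: (mulfI x0); rewrite mulr1 -exprS card_predK expf_card.
Qed.

(** Otherwise ['X^m - 1], with [m] the remainder of [n] modulo [q - 1], would
have [q - 1 > m] roots. *)
Lemma exists_expf_neq1 n : ~~ (N %| n)%N -> exists2 b : k, b != 0 & b ^+ n != 1.
Proof.
move=> ndvd; pose m := (n %% N)%N.
have N0 : (0 < N)%N by rewrite -ltnS card_predK finNzRing_gt1.
have m0 : (0 < m)%N by rewrite lt0n.
have ltmN : (m < N)%N by rewrite ltn_mod.
have [/existsP[b /andP[b0 bm]]|/existsPn all1] :=
  boolP [exists b : k, (b != 0) && (b ^+ m != 1)].
  exists b => //; rewrite (divn_eq n N) exprD mulnC exprM expf_pred_card //.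
  by rewrite expr1n mul1r.
have nzp : 'X^m - 1 != 0 :> {poly k}.
  by rewrite -size_poly_eq0 -polyC1 size_XnsubC.
pose rs := enum [pred x : k | x != 0].
have rs_root : all (root ('X^m - 1)) rs.
  apply/allP=> b; rewrite mem_enum inE => b0.
  rewrite /root !hornerE subr_eq0.
  by have := all1 b; rewrite b0 negbK.
have := max_poly_roots nzp rs_root (enum_uniq _).
rewrite -polyC1 size_XnsubC // -cardE ltnS leqNgt.
suff -> : #|[pred x : k | x != 0]| = N by rewrite ltmN.
by rewrite -(cardC1 0); apply: eq_card.
Qed.

Lemma sum_expf n : ~~ (N %| n)%N -> \sum_t iota t ^+ n = 0.
Proof.
case/exists_expf_neq1=> b b0 bn.
have : \sum_t iota t ^+ n == \sum_t iota (b * t) ^+ n.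
  by rewrite [X in X == _](reindex_inj (mulfI b0)).
under [in X in _ == X]eq_bigr => t _ do rewrite rmorphM exprMn.
rewrite -mulr_sumr -subr_eq0 -[X in X - _]mul1r -mulrBl mulf_eq0 => /orP[|/eqP//].
by rewrite subr_eq0 -rmorphXn eq_sym -(rmorph1 iota) (inj_eq (fmorph_inj iota))
  (negPf bn).
Qed.

Lemma sum_exp_pred_card : \sum_t iota t ^+ N = -1.
Proof.
rewrite (bigD1 0) //= rmorph0 expr0n.
have N0 : (0 < N)%N by rewrite -ltnS card_predK finNzRing_gt1.
rewrite eqn0Ngt N0 add0r; under eq_bigr => t t0.
  rewrite -rmorphXn expf_pred_card // rmorph1; over.
rewrite sumr_const (@eq_card _ _ (predC1 0)) // cardC1.
by apply/eqP; rewrite -addr_eq0 -mulrSr card_predK card_natr0.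
Qed.

(** Only the exponents [0] and the positive multiples of [q - 1] can contribute
to a power sum; the first one contributes [q = 0], and below [2 (q - 1)] the
only other is [q - 1]. *)
Lemma sum_horner (A : {poly L}) : (size A <= N.*2)%N ->
  \sum_t A.[iota t] = - A`_N.
Proof.
move=> sA; under eq_bigr => t _ do rewrite horner_coef.
rewrite exchange_big /=.
transitivity (\sum_(i < size A) A`_i * \sum_t iota t ^+ i).
  by apply: eq_bigr => i _; rewrite mulr_sumr.
have N0 : (0 < N)%N by rewrite -ltnS card_predK finNzRing_gt1.
have sum0 (i : 'I_(size A)) : i != N :> nat -> A`_i * \sum_t iota t ^+ i = 0.
  move=> iN; have [i0|i0] := posnP i.
    rewrite i0; under eq_bigr => t _ do rewrite expr0.
    by rewrite sumr_const card_natr0 mulr0.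
  rewrite sum_expf ?mulr0 //; apply/negP => /dvdnP[q iq].
  have : (i < N.*2)%N by apply: leq_trans sA.
  rewrite iq -muln2 mulnC ltn_pmul2l // ltnS leq_eqVlt => /orP[/eqP q1|].
    by rewrite iq q1 mul1n eqxx in iN.
  by rewrite ltnS leqn0 => /eqP q0; rewrite iq q0 in i0.
have [ltN|leN] := ltnP N (size A).
  rewrite (bigD1 (Ordinal ltN)) //= [X in _ + X]big1 => [|i iN]; last first.
    by apply: sum0; apply: contraNneq iN => iN; apply/eqP/val_inj.
  by rewrite sum_exp_pred_card mulrN1 addr0.
rewrite big1 => [|i _]; first by rewrite nth_default ?oppr0.
by apply: sum0; rewrite neq_ltn (leq_trans (ltn_ord i) leN).
Qed.

End PowerSums.

(** * Functions of the bottom row and weights *)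

Section BottomRow.
Variables (k : finFieldType) (L : fieldType).
Local Notation U := (upper_unip_group k).

Fact of_row_subproof (F : k -> k -> k -> L) :
  ([ffun g : {'GL_2[k]} => F (g ord_max ord0) (g ord_max ord_max) (\det g)]
    : {ffun _ -> L^o}) \in @left_inv _ U L.
Proof.
apply/left_invP => _ g /upper_unipP[t ->]; rewrite !ffunE.
have [a [b [c [d [nz ->]]]]] := gl_case g.
have nz' : (1 * a + t * c) * (0 * b + 1 * d) - (1 * b + t * d) * (0 * a + 1 * c)
  != 0.
  rewrite [X in X != 0](_ : _ = a * d - b * c) //; by ring.
rewrite glM ?unip_nz // !glK // !det_mx2 !mxE /=.
by congr F; ring.
Qed.

(** The bottom row and the determinant are the invariants of the left action of
[U]. *)
Definition of_row F : induced U L := Induced (of_row_subproof F).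

Lemma of_rowE F a b c d : a * d - b * c != 0 ->
  of_row F (gl a b c d) = F c d (a * d - b * c).
Proof. by move=> nz; rewrite ffunE glK // det_mx2 !mxE. Qed.

End BottomRow.

Section Weights.

Variables (k : finFieldType) (L : fieldType).
Variable (iota : {rmorphism k -> L}).
Local Notation U := (upper_unip_group k).
Local Notation C := (induced U L).
Local Notation H := (endo U L).
Local Notation S := (@torus_shift k L).
Local Notation hom := (@homothety _ U L).
Implicit Types (f : C) (m : nat).

(** The action of the cocharacter [diag(a^-1, a)]; for a function of the bottom
row this is homogeneity of degree [m]. *)
Definition has_weight m f := forall e, S (e^-1%g, e) f = iota (val e) ^+ m *: f.

Lemma weightE m f (e : {unit k}) a b c d : has_weight m f ->
  a * d - b * c != 0 ->
  f (gl (val e^-1%g * a) (val e^-1%g * b) (val e * c) (val e * d)) =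
  iota (val e) ^+ m * f (gl a b c d).
Proof.
by move=> fm nz; rewrite -[LHS](torus_shiftE f (e^-1%g, e)) // fm inducedZ.
Qed.

Lemma weight_coord0 m f a b d : has_weight m f -> a * d != 0 ->
  f (gl a b 0 d) = iota d ^+ m * f (gl (a * d) 0 0 1).
Proof.
move=> fm nz; have := nz; rewrite mulf_eq0 negb_or => /andP[a0 d0].
have nzD : (a * d) * 1 - 0 * 0 != 0 by rewrite mulr1 mulr0 subr0.
rewrite -(weightE (finField_unit d0) fm nzD) /=.
have nz2 : a * d - b * 0 != 0 by rewrite mulr0 subr0.
rewrite -(inducedU_gl f (- b / d) nz2).
by congr (f (gl _ _ _ _)); field.
Qed.

(** The values [f (gl 0 (- D) 1 y)] and [f (gl D 0 0 1)] are the coordinates of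
a function of given weight: [y] runs over the affine part of the projective line
of bottom rows, and [(0 : 1)] is the point at infinity. *)
Lemma weight_coord m f a b c d : has_weight m f -> a * d - b * c != 0 ->
  c != 0 ->
  f (gl a b c d) = iota c ^+ m * f (gl 0 (- (a * d - b * c)) 1 (d / c)).
Proof.
move=> fm nz c0; set D := - _.
have nzD : 0 * (d / c) - D * 1 != 0 by rewrite mul0r sub0r mulr1 opprK.
rewrite -(weightE (finField_unit c0) fm nzD) /=.
rewrite -(inducedU_gl f (- a / c) nz).
by congr (f (gl _ _ _ _)); rewrite /D; field.
Qed.

(** Minus the projector on weight [m], the order of the group of units being
[-1]. *)
Definition weight_op m : H :=
  \sum_(e : {unit k}) hom (iota (val e) ^- m) * S (e^-1%g, e).

Lemma weight_op_weight m f : has_weight m (weight_op m f).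
Proof.
move=> e; rewrite -homothetyE -!endoM; congr (endo_val _ f).
rewrite /weight_op !mulr_sumr [RHS](reindex_inj (mulIg e)).
apply: eq_bigr => e' _.
rewrite mulrA homothety_comm -mulrA torus_shiftM [RHS]mulrA -homothetyM.
congr (hom _ * S _).
  rewrite rmorphM exprMn invfM mulrCA mulfV ?mulr1 //.
  by rewrite expf_neq0 // fmorph_eq0 unit_nz.
by rewrite invMg; congr pair; apply/val_inj; rewrite /= mulrC.
Qed.

End Weights.

(** * Failure of flatness over a non-prime field *)

Section NonFlat.

Variables (k : finFieldType) (p : nat) (L : fieldType).
Variable (iota : {rmorphism k -> L}).
Hypotheses (hp : p \in [pchar k]) (ltp : (p < #|k|.-1)%N).
Local Notation U := (upper_unip_group k).
Local Notation C := (induced U L).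
Local Notation H := (endo U L).
Local Notation tau := (tau k L).
Local Notation S := (@torus_shift k L).
Local Notation delta := (delta U L).
Local Notation weight := (weight_op iota p).

Let p_pr : prime p := pcharf_prime hp.
Let p0 : (0 < p)%N := prime_gt0 p_pr.

(** The element [x^(p-1) y] of weight [p] that [tau] kills but does not reach.
*)
Definition monomial : C := of_row (fun c d _ => iota c ^+ p.-1 * iota d).

(** The summand is a polynomial of degree at most [p < q - 1] in [t]. *)
Lemma sum_affine (a b c d : k) :
  \sum_t iota (a + t * c) ^+ p.-1 * iota (b + t * d) = 0.
Proof.
pose lin (x y : k) : {poly L} := iota x *: 'X + (iota y)%:P.
have lin_size x y : (size (lin x y) <= 2)%N.
  rewrite (leq_trans (size_polyD _ _)) // geq_max.
  by rewrite (leq_trans (size_scale_leq _ _)) ?size_polyX // ltnW // ltnS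
    size_polyC_leq1.
pose A := lin c a ^+ p.-1 * lin d b.
have szlinX : (size (lin c a ^+ p.-1) <= p)%N.
  rewrite (leq_trans (size_poly_exp_leq _ _)) // -[leqRHS](prednK p0) ltnS.
  rewrite -[leqRHS]mul1n leq_mul2r.
  by have := lin_size c a; case: (size _) => [|[|[|]]] //=; rewrite orbT.
have szA : (size A <= p.+1)%N.
  rewrite (leq_trans (size_polyMleq _ _)) // -subn1 leq_subLR add1n -addn2.
  exact: leq_add.
rewrite -[RHS]oppr0 -[X in - X](nth_default 0 (leq_trans szA ltp)).
rewrite -(sum_horner iota); last first.
  by rewrite -addnn (leq_trans szA) // (leq_trans ltp) // leq_addl.
apply: eq_bigr => t _; rewrite /A /lin !hornerE !rmorphD !rmorphM /=.
by congr (_ ^+ _ * _); ring.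
Qed.

Lemma tau_monomial : tau monomial = 0.
Proof.
apply: induced_glP => a b c d nz; rewrite tauE // induced0.
under eq_bigr => t _ do rewrite of_rowE ?tau_sum_nz //.
exact: sum_affine.
Qed.

Lemma weight_op_monomial : weight monomial = - monomial.
Proof.
apply: induced_glP => a b c d nz; rewrite endo_sum induced_sum.
transitivity (\sum_(e : {unit k}) monomial (gl a b c d)).
  apply: eq_bigr => e _; have nz' := detM (e^-1%g, e) nz.
  rewrite endoM homothetyE inducedZ torus_shiftE // !of_rowE //= !rmorphM exprMn.
  have e0 : iota (FinRing.uval e) != 0 by rewrite fmorph_eq0 (unit_nz e).
  rewrite -[in X in X^-1](prednK p0) exprSr.
  have ep := expf_neq0 p.-1 e0; move: (iota _ ^+ p.-1) ep => E E0.
  by field; rewrite e0.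
by rewrite sumr_const -mulr_natl (card_unit_natr (card_natr0 iota)) mulN1r
  inducedN.
Qed.

Lemma sum_scaled_expf (x : k) : \sum_t iota (t * x) ^+ p = 0.
Proof.
under eq_bigr => t _ do rewrite rmorphM exprMn.
rewrite -mulr_suml sum_expf ?mul0r //.
by rewrite gtnNdvd.
Qed.

(** A biinvariant function of weight [p] is determined, for each determinant, by
one value on each of the two Bruhat cells. On the open cell it is a multiple of
the [p]-th power of the lower left entry. On the closed cell it vanishes,
because [tau] computes there the value plus a sum over [t] of multiples of
[t^p], and [0 < p < q - 1]. The power vanishes on the closed cell as well. *)
Lemma ker_tau_power (h : H) : tau * (weight * h) = 0 ->
  forall a b c d, a * d - b * c != 0 ->
  (weight * h) delta (gl a b c d) =
  iota c ^+ p * (weight * h) delta (gl 0 (- (a * d - b * c)) 1 0).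
Proof.
move=> tau0; set f := (weight * h) delta.
have fp : has_weight iota p f by exact: weight_op_weight.
have fc a b c d : c != 0 -> a * d - b * c != 0 ->
    f (gl a b c d) = iota c ^+ p * f (gl 0 (- (a * d - b * c)) 1 0).
  move=> c0 nz; rewrite (weight_coord fp nz c0); congr (_ * _).
  set D := - _; have nzD : 0 * (d / c) - D * 1 != 0.
    by rewrite mul0r sub0r mulr1 opprK.
  rewrite -(endo_deltaU _ _ (unip_in (- (d / c)))) glM ?unip_nz //.
  by congr (f (gl _ _ _ _)); ring.
move=> a b c d nz; have [c0|] := eqVneq c 0; last by move/fc; apply.
rewrite c0 rmorph0 expr0n eqn0Ngt p0 mul0r.
rewrite c0 !mulr0 subr0 in nz *.
have := nz; rewrite mulf_eq0 negb_or => /andP[a0 d0].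
rewrite (weight_coord0 _ fp nz); set D := a * d in nz *.
have nzw : 0 * 0 - 1 * D != 0 by rewrite mul0r mul1r sub0r oppr_eq0.
have sum0 : \sum_(t | t != 0) f (gl D 0 (0 + t * D) (1 + t * 0)) = 0.
  transitivity (\sum_t iota (t * D) ^+ p * f (gl 0 (- D) 1 0)).
    rewrite [RHS](bigD1 0) //= mul0r rmorph0 expr0n eqn0Ngt p0 mul0r add0r.
    apply: eq_bigr => t t0; rewrite add0r mulr0 addr0 fc ?mulf_neq0 //.
      by rewrite mulr1 mul0r subr0.
    by rewrite mul0r mulr1 subr0.
  by rewrite -mulr_suml sum_scaled_expf mul0r.
have tf : tau f = 0 by rewrite /f -endoM tau0.
(* The term [t = 0] of this sum is the value on the closed cell. *)
have := tauE f nzw; rewrite tf induced0 (bigD1 0) // sum0.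
by rewrite !mul0r !addr0 [RHS]addr0 => <-; rewrite mulr0.
Qed.

(** Matrices of determinant [1] with bottom row [(1, x)]. *)
Definition gl1x (x : k) : {'GL_2[k]} := gl 0 (- 1) 1 x.

Lemma gl1x_nz (x : k) : 0 * x - - 1 * 1 != 0.
Proof. by rewrite mul0r mulr1 opprK add0r oner_eq0. Qed.

Lemma gl1x_mul (x a b c d : k) : a * d - b * c != 0 ->
  (gl1x x * gl a b c d)%g = gl (- c) (- d) (a + x * c) (b + x * d).
Proof. by move=> nz; rewrite glM ?gl1x_nz //; congr gl; ring. Qed.

(** The failure of additivity at [(1, 1) = (1, 0) + (0, 1)] of the component of
weight [p]: zero on [p]-th powers of linear forms, but not on [monomial]. *)
Definition defect (f : C) : L :=
  weight f (gl1x 1) - weight f (gl1x 0) - weight f 1%g.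

Fact defect_is_zmod_morphism : zmod_morphism defect.
Proof.
move=> f f'; rewrite /defect raddfB !(inducedD, inducedN); ring.
Qed.

Lemma defect_monomial : defect monomial = - 1.
Proof.
rewrite /defect weight_op_monomial !inducedN -gl1 !of_rowE ?gl1x_nz //;
  last first.
  by rewrite mulr1 mul0r subr0 oner_eq0.
have p1 : (0 < p.-1)%N by rewrite -ltnS prednK // prime_gt1.
rewrite rmorph1 rmorph0 expr1n expr0n eqn0Ngt p1 ?(mul1r, mulr1, mulr0, mul0r).
by rewrite oppr0 !subr0.
Qed.

(** The test applies to [a = tau * weight_op]. If [a h = 0], then [h f] has its
component of weight [p] spanned by right translates of the function in
[ker_tau_power], which are [p]-th powers of linear forms, on which [defect]
vanishes. *)
Lemma not_flat_of_lt :
  ~ flat (induced_endo (upper_unip k) L : lmodType (endo (upper_unip k) L)).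
Proof.
move=> flatC.
pose b : {additive induced_endo U L -> L} :=
  HB.pack (defect : induced_endo U L -> L)
   (GRing.isZmodMorphism.Build _ _ _ defect_is_zmod_morphism).
have /eqP : b monomial = 0.
  apply: (@flat_annihilated H (induced_endo U L) (tau * weight)) => //.
    rewrite -[LHS]/(tau (weight monomial)) weight_op_monomial.
    by rewrite -scaleN1r endo_homothety tau_monomial scaler0.
  move=> h f; rewrite -mulrA => tau0.
  rewrite -[LHS]/(defect (h f)) /defect -!endoM !endo_delta -!sumrB.
  apply: big1 => A _; rewrite -!mulrBr.
  set x := (fingroup.repr A)^-1%g.
  have [a' [b' [c' [d' [nz ->]]]]] := gl_case x.
  rewrite mul1g !gl1x_mul // !mul1r !mul0r !addr0.
  have dets y : - c' * (b' + y * d') - - d' * (a' + y * c') = a' * d' - b' * c'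
    by ring.
  have nzy y : - c' * (b' + y * d') - - d' * (a' + y * c') != 0 by rewrite dets.
  have := nzy 1; have := nzy 0; have := dets 1; have := dets 0.
  rewrite !mul1r !mul0r !addr0 => d0 d1 n0 n1.
  rewrite (ker_tau_power tau0 nz) (ker_tau_power tau0 n0) (ker_tau_power tau0 n1).
  rewrite d0 d1 -!mulrBl rmorphD exprDn_pchar; last first.
    by rewrite (pnatE _ p_pr) (rmorph_pchar iota hp).
  by rewrite addrAC addrK subrr mul0r mulr0.
by rewrite /b /= defect_monomial oppr_eq0 oner_eq0.
Qed.

End NonFlat.

(** * Exactness of tau over a prime field *)

Section Exact.

Variables (k : finFieldType) (L : fieldType).
Variable (iota : {rmorphism k -> L}).
Local Notation U := (upper_unip_group k).
Local Notation C := (induced U L).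
Local Notation H := (endo U L).
Local Notation tau := (tau k L).
Local Notation theta := (theta k L).
Local Notation S := (@torus_shift k L).
Local Notation N := (#|k|.-1).
Implicit Types (f : C) (m : nat) (A : {poly L}).

(** Lagrange interpolation on all of [k], where [1 - (X - x)^(q-1)] is the
indicator of [x]. *)
Definition interpolation (alpha : k -> L) : {poly L} :=
  \sum_x alpha x *: (1 - ('X - (iota x)%:P) ^+ N).

Lemma card_pred_gt0 : (0 < N)%N.
Proof. by rewrite -ltnS card_predK finNzRing_gt1. Qed.

Lemma interpolation_size alpha : (size (interpolation alpha) <= #|k|)%N.
Proof.
rewrite /interpolation; elim/big_rec: _ => [|x A _ IH];
  first by rewrite size_poly0.
rewrite (leq_trans (size_polyD _ _)) // geq_max IH andbT.
rewrite (leq_trans (size_scale_leq _ _)) // (leq_trans (size_polyD _ _)) //.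
by rewrite size_poly1 size_polyN size_exp_XsubC geq_max card_predK leqnn
  -card_predK.
Qed.

Lemma interpolationE alpha y : (interpolation alpha).[iota y] = alpha y.
Proof.
rewrite /interpolation horner_sum (bigD1 y) //= big1 => [|x xy].
  by rewrite !hornerE subrr expr0n eqn0Ngt card_pred_gt0 subr0 mulr1 ?addr0.
rewrite !hornerE -rmorphB -rmorphXn expf_pred_card ?rmorph1 ?subrr ?mulr0 //.
by rewrite subr_eq0 eq_sym.
Qed.

Lemma poly_all_roots A :
  (size A <= #|k|)%N -> (forall y, A.[iota y] = 0) -> A = 0.
Proof.
move=> sA A0; apply/eqP; apply: contraLR sA => nzA; rewrite -ltnNge.
rewrite cardE -(size_map iota); apply: max_poly_roots => //.
  by apply/allP => _ /mapP[y _ ->]; apply/eqP.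
by rewrite map_inj_uniq ?enum_uniq //; apply: fmorph_inj.
Qed.

(** By Taylor expansion, the sum picks the coefficient of [s^m] in [A (d + s)],
the only exponent [i] for which [N - m + i = N]. *)
Lemma sum_shift_horner A m (d : k) : (0 < m < N)%N -> (size A <= #|k|)%N ->
  \sum_s iota s ^+ (N - m) * A.[iota (d + s)] = - A^`N(m).[iota d].
Proof.
move=> /andP[m0 mN] sA; pose B := \poly_(i < size A) A^`N(i).[iota d].
transitivity (\sum_s (B * 'X^(N - m)).[iota s]).
  apply: eq_bigr => s _; rewrite !hornerE mulrC; congr (_ * _).
  rewrite rmorphD nderiv_taylor; last exact: mulrC.
  by rewrite horner_poly.
rewrite sum_horner; last first.
  rewrite (leq_trans (size_polyMleq _ _)) // size_polyXn addnS /=.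
  rewrite -addnn -[X in (_ <= _ + X)%N](subnK (ltnW mN)) addnCA addnC leq_add2l.
  rewrite (leq_trans (size_poly _ _)) // (leq_trans sA) //.
  by rewrite -[leqLHS]card_predK -[ltnLHS]addn0 ltn_add2l.
rewrite coefMXn ltnNge leq_subr /= subKn ?(ltnW mN) // coef_poly.
by case: ltnP => // /nderivn_poly0 ->; rewrite horner0.
Qed.

Lemma weight_eq0 m f : has_weight iota m f ->
  (forall D, D != 0 -> f (gl D 0 0 1) = 0) ->
  (forall D y, D != 0 -> f (gl 0 (- D) 1 y) = 0) -> f = 0.
Proof.
move=> fm f0 f1; apply: induced_glP => a b c d nz; rewrite induced0.
have [c0|c0] := eqVneq c 0; last by rewrite (weight_coord fm) ?f1 ?mulr0.
rewrite c0 mulr0 subr0 in nz.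
by rewrite c0 (weight_coord0 _ fm) ?f0 ?mulr0.
Qed.

(** The bottom rows [(0, - D) + t (1, d)] in the sum consist of a point at
infinity, for [t = 0], and of the rows [(t, t y)] with [y = d - D / t]. The
substitution [t = - D / s] turns the sum into that of [sum_shift_horner], whose
value is a divided derivative. *)
Lemma tau_coord m f A (D d : k) : (0 < m < N)%N -> has_weight iota m f ->
  D != 0 -> (size A <= #|k|)%N ->
  (forall y, A.[iota y] = f (gl 0 D 1 y)) ->
  tau f (gl 0 (- D) 1 d) =
  iota (- D) ^+ m * (f (gl (- D) 0 0 1) - A^`N(m).[iota d]).
Proof.
move=> mN fm D0 sA Af.
have nz : 0 * d - - D * 1 != 0 by rewrite mul0r sub0r mulr1 opprK.
rewrite tauE // (bigD1 0) //= mul0r addr0 mul0r addr0.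
rewrite (weight_coord0 _ fm) ?mul1r ?oppr_eq0 // mulrBr; congr (_ + _).
rewrite -mulrN -sum_shift_horner // mulr_sumr.
have /andP[m0 ltmN] := mN.
rewrite [RHS](bigD1 0) //= rmorph0 expr0n subn_eq0 leqNgt ltmN /=.
rewrite mul0r mulr0 add0r.
have inv_inj : injective (fun s : k => - D / s).
  by move=> s s' /mulfI => /(_ _)/invr_inj; apply; rewrite oppr_eq0.
rewrite (reindex_inj inv_inj) /=; apply: eq_big => [s|s s0].
  by rewrite mulf_eq0 invr_eq0 oppr_eq0 (negPf D0).
have {}s0 : s != 0.
  by move: s0; rewrite mulf_eq0 invr_eq0 oppr_eq0 (negPf D0).
have nz' : 1 * (- D + (- D / s) * d) - d * (0 + (- D / s) * 1) != 0.
  by rewrite [X in X != 0](_ : _ = - D) ?oppr_eq0 //; ring.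
rewrite (weight_coord fm nz') ?add0r ?mulr1; last first.
  by rewrite mulf_neq0 ?oppr_eq0 ?invr_eq0.
rewrite rmorphM exprMn -[LHS]mulrA; congr (_ * _).
rewrite fmorphV exprVn.
have -> : (iota s ^+ m)^-1 = iota s ^+ (N - m).
  have sm : iota s ^+ m != 0 by rewrite expf_neq0 // fmorph_eq0.
  apply: (mulfI sm); rewrite mulfV // -exprD subnKC ?(ltnW ltmN) //.
  by rewrite -rmorphXn expf_pred_card // rmorph1.
rewrite Af; congr (_ * f (gl _ _ _ _)); field;
  by rewrite ?oppr_eq0 s0 ?D0.
Qed.

Lemma sum_unit_exp m : (0 < m < N)%N -> \sum_(e : {unit k}) iota (val e) ^+ m = 0.
Proof.
move=> /andP[m0 mN]; rewrite -(big_unit (fun t : k => iota t ^+ m)).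
have := sum_expf iota (_ : ~~ (N %| m)%N).
by rewrite gtnNdvd // => /(_ isT);
  rewrite (bigD1 0) //= rmorph0 expr0n eqn0Ngt m0 add0r.
Qed.

(** In nonzero weight, [theta] sums a nontrivial character over the units. *)
Lemma theta_weight m f : (0 < m < N)%N -> has_weight iota m f -> theta f = 0.
Proof.
move=> mN fm; rewrite endo_sum.
transitivity (\sum_(e : {unit k}) iota (val e) ^+ m *: S (unit_opp 1%g, 1%g) f).
  apply: eq_bigr => e _; rewrite -endo_homothety -fm -endoM torus_shiftM.
  have -> // : (unit_opp e^-1, e)%g = ((unit_opp 1, 1) * (e^-1, e))%g.
  by apply: (congr2 pair);
    [rewrite [RHS]/= /unit_opp mulg1|rewrite [RHS]/= mul1g].
by rewrite -scaler_suml (sum_unit_exp mN) scale0r.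
Qed.

Lemma tau_weight m f : (m <= N)%N -> has_weight iota (N - m) f ->
  has_weight iota m (tau f).
Proof.
move=> mN fm e; rewrite -endoM torus_shift_tau endoM.
have -> : swap (e^-1%g, e) = ((e^-1)^-1%g, e^-1%g) by rewrite invgK.
rewrite fm endo_homothety; congr (_ *: _).
have e0 : iota (val e) ^+ (N - m) != 0 by rewrite expf_neq0 // fmorph_eq0 unit_nz.
rewrite /= fmorphV exprVn; apply: (mulfI e0); rewrite mulfV // -exprD subnK //.
by rewrite -rmorphXn expf_pred_card ?rmorph1 ?(unit_nz e).
Qed.

Hypothesis k_pchar : #|k| \in [pchar k].

Lemma bin_neq0 i j : (i < #|k|)%N -> (j <= i)%N -> 'C(i, j)%:R != 0 :> L.
Proof.
move=> ik ji; have pL := rmorph_pchar iota k_pchar.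
rewrite -(dvdn_pcharf pL); have p_pr := pcharf_prime pL.
have fact_dvd n : (n < #|k|)%N -> ~~ (#|k| %| n`!)%N.
  elim: n => [|n IHn] nk; first by rewrite dvdn1 neq_ltn finNzRing_gt1 orbT.
  by rewrite factS Euclid_dvdM // negb_or IHn ?(ltnW nk) // gtnNdvd.
by apply: contra (fact_dvd i ik) => dv; rewrite -(bin_fact ji) dvdn_mulr.
Qed.

(** The extension of weight [m] of polynomials in the affine coordinate, chosen
to vanish at infinity. *)
Definition homogeneous_fun m (B : k -> {poly L}) : C :=
  of_row (fun c d D => if c == 0 then 0 else iota c ^+ m * (B D).[iota (d / c)]).

Lemma homogeneous_funP m B : has_weight iota m (homogeneous_fun m B).
Proof.
move=> e; apply: induced_glP => a b c d nz; have nz' := detM (e^-1%g, e) nz.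
rewrite torus_shiftE // inducedZ !of_rowE // mulf_eq0 (negPf (unit_nz e)) /=.
case: eqVneq => c0; first by rewrite mulr0.
have e0 : FinRing.uval e != 0 := unit_nz e.
rewrite [RHS]mulrA -[in RHS]exprMn -rmorphM.
by congr (_ * (B _).[iota _]); field; rewrite ?e0 ?c0.
Qed.

(** Interpolate [f] on the affine part by polynomials [A D]. By [tau_coord] the
equation [tau f = 0] says that the [m]-th divided derivative of [A D] is a
constant, equal to the value at infinity; as no binomial coefficient vanishes,
[A D] has degree at most [m]. For the same reason [A D] is, up to a scalar, the
divided derivative of order [r = q - 1 - m] of some [B D] of degree less than
[q], so the function of weight [r] given by [B] is sent by [tau] to a function
equal to [f] on the affine part. The difference is killed by [tau], and the same
equation shows that it vanishes at infinity too. *)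
Lemma tau_exact_weight m f : (0 < m < N)%N -> has_weight iota m f -> tau f = 0 ->
  exists f', tau f' = f.
Proof.
move=> mN fm tf; have /andP[m0 ltmN] := mN.
pose A D := interpolation (fun y => f (gl 0 D 1 y)).
have A_size D : (size (A D) <= #|k|)%N by apply: interpolation_size.
have AE D y : (A D).[iota y] = f (gl 0 D 1 y) by rewrite interpolationE.
have AN D : D != 0 -> (A D)^`N(m) = (f (gl (- D) 0 0 1))%:P.
  move=> D0; apply/eqP; rewrite -subr_eq0; apply/eqP; apply: poly_all_roots.
    rewrite (leq_trans (size_polyD _ _)) // geq_max size_polyN.
    rewrite (leq_trans (size_polyC_leq1 _)) ?(ltnW (finNzRing_gt1 k)) // andbT.
    rewrite (leq_trans (size_poly _ _)) // (leq_trans (leq_subr _ _)) //.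
  move=> y; have := tau_coord y mN fm D0 (A_size D) (AE D).
  rewrite tf induced0 => /esym/eqP; rewrite mulf_eq0 expf_eq0 fmorph_eq0.
  rewrite oppr_eq0 (negPf D0) andbF /= subr_eq0 => /eqP fE.
  by rewrite !hornerE -fE subrr.
have Asmall D i : D != 0 -> (m < i)%N -> (A D)`_i = 0.
  move=> D0 mi; have [iq|] := ltnP i #|k|; last first.
    by move=> qi; rewrite nth_default // (leq_trans (A_size D)).
  have := congr1 (fun P : {poly L} => P`_(i - m)) (AN D D0).
  rewrite coefC subn_eq0 leqNgt mi /= coef_nderivn subnKC ?(ltnW mi) //.
  move/eqP; rewrite -mulr_natr mulf_eq0 (negPf (bin_neq0 iq (ltnW mi))) orbF.
  by move/eqP.
(* [tau] sends weight [r] to weight [- r], which is [m] modulo [q - 1]. *)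
pose r := (N - m)%N.
pose B E : {poly L} := \poly_(i < #|k|)
  (if (i < r)%N then 0
   else - (iota E ^+ r)^-1 * (A E)`_(i - r) / 'C(i, r)%:R).
have rN : (0 < r < N)%N by rewrite subn_gt0 ltmN ltn_subrL m0 card_pred_gt0.
have B_size E : (size (B E) <= #|k|)%N by apply: size_poly.
have BN E : E != 0 -> (B E)^`N(r) = - (iota E ^+ r)^-1 *: A E.
  move=> E0; apply/polyP => i; rewrite coef_nderivn coefZ coef_poly.
  have -> : (r + i < r)%N = false by rewrite ltnNge leq_addr.
  rewrite addKn; have [iq|iq] := ltnP (r + i) #|k|.
    by rewrite -[LHS]mulr_natr divfK ?bin_neq0 ?leq_addr.
  rewrite mul0rn Asmall ?mulr0 //.
  rewrite -(ltn_add2l r) (leq_trans _ iq) // subnK ?(ltnW ltmN) //.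
  by rewrite card_predK.
pose f' := homogeneous_fun r B.
have f'r : has_weight iota r f' by apply: homogeneous_funP.
have f'm : has_weight iota m (tau f') by apply: (tau_weight (ltnW ltmN)).
pose g := f - tau f'.
have gm : has_weight iota m g.
  by move=> e; rewrite /g endo_add -scaleN1r endo_homothety fm f'm scalerDr
     !scalerA mulrC.
have tg : tau g = 0.
  rewrite /g endo_add tf -scaleN1r endo_homothety -endoM
    (tau_tau (card_natr0 iota)).
  by rewrite endoM (theta_weight mN f'm) scaler0 addr0.
exists f'; apply/esym/eqP; rewrite -subr_eq0; apply/eqP; rewrite -/g.
have g1 D y : D != 0 -> g (gl 0 (- D) 1 y) = 0.
  move=> D0; rewrite /g inducedD inducedN.
  have nzD z : 0 * z - D * 1 != 0 by rewrite mul0r sub0r mulr1 oppr_eq0.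
  have f'E z : (B (- D)).[iota z] = f' (gl 0 D 1 z).
    rewrite of_rowE // oner_eq0 rmorph1 expr1n mul1r divr1.
    by rewrite mul0r sub0r mulr1.
  rewrite (tau_coord y rN f'r D0 (B_size _) f'E) of_rowE; last first.
    by rewrite mulr1 mulr0 subr0 oppr_eq0.
  rewrite eqxx sub0r BN ?oppr_eq0 // hornerZ mulNr opprK mulrA.
  rewrite mulfV ?mul1r.
    by rewrite AE subrr.
  by rewrite expf_neq0 // fmorph_eq0 oppr_eq0.
apply: (weight_eq0 gm) => // D D0.
have D0' : - D != 0 by rewrite oppr_eq0.
have g0 y : (0 : {poly L}).[iota y] = g (gl 0 (- D) 1 y) by rewrite horner0 g1.
have := tau_coord 0 mN gm D0' _ g0; rewrite size_poly0 => /(_ isT).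
rewrite tg induced0 raddf0 horner0 subr0 opprK => /esym/eqP.
by rewrite mulf_eq0 expf_eq0 fmorph_eq0 (negPf D0) andbF => /eqP.
Qed.

End Exact.

(** * The contraction and flatness over a prime field *)

Section LinearSection.

Variables (gT : finGroupType) (U : {group gT}) (L : fieldType).
Local Notation C := (induced U L).
Local Notation V := {ffun gT -> L^o}.

Fact coset_proj_subproof (f : V) :
  ([ffun g => f (fingroup.repr (U :* g)%g)] : V) \in @left_inv gT U L.
Proof.
apply/left_invP => u g uU; rewrite !ffunE; congr (f (fingroup.repr _)).
by rewrite rcosetM rcoset_id.
Qed.

Definition coset_proj f : C := Induced (coset_proj_subproof f).

Fact coset_proj_is_linear : linear coset_proj.
Proof. by move=> a f f'; apply/inducedP => g;
  rewrite inducedD inducedZ !ffunE. Qed.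

Lemma coset_projK (f : C) : coset_proj (val f) = f.
Proof.
apply/inducedP => g; rewrite ffunE; case: repr_rcosetP => u uU.
exact: inducedU.
Qed.

(** [C] is a retract of the finite dimensional space of all functions on [G],
where linear maps have partial inverses. *)
Lemma linear_section (h : {linear C -> C}) :
  exists s : {linear C -> C}, forall f, h (s (h f)) = h f.
Proof.
pose pi : {linear V -> C} :=
  HB.pack coset_proj (GRing.isLinear.Build _ _ _ _ _ coset_proj_is_linear).
pose inc : {linear C -> V} := val.
pose T : 'End(V) := linfun (inc \o h \o pi).
exists (pi \o (T^-1)%VF \o inc : {linear C -> C}) => f.
have TE v : T v = val (h (pi v)) by rewrite lfunE.
apply: val_inj; rewrite -TE /=.
have -> : val (h f) = T (val f) by rewrite TE /pi /= coset_projK.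
by rewrite limg_lfunVK // memv_img ?memvf.
Qed.

End LinearSection.

Section Flat.

Variables (k : finFieldType) (L : fieldType).
Variable (iota : {rmorphism k -> L}).
Local Notation U := (upper_unip_group k).
Local Notation C := (induced U L).
Local Notation H := (endo U L).
Local Notation tau := (tau k L).
Local Notation theta := (theta k L).
Local Notation tau' := (tau' k L).
Local Notation S := (@torus_shift k L).
Local Notation N := (#|k|.-1).
Local Notation hom := (@homothety _ U L).
Implicit Types (f : C) (m : nat).

Let q0 : #|k|%:R = 0 :> L := card_natr0 iota.

(** Minus the projector on weight [0]; see [weight_op0]. *)
Definition omega : H := \sum_(e : {unit k}) S (e^-1%g, e).

Lemma coroot_omega (e : {unit k}) : S (e^-1%g, e) * omega = omega.
Proof.
rewrite /omega mulr_sumr [RHS](reindex_inj (mulgI e)).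
apply: eq_bigr => e' _; rewrite torus_shiftM; congr S; congr pair.
by rewrite invMg; apply/val_inj; rewrite /= mulrC.
Qed.

Lemma omega_omega : omega * omega = - omega.
Proof.
rewrite {1}/omega mulr_suml; under eq_bigr => e _ do rewrite coroot_omega.
rewrite sumr_const; apply/endoP => f.
have -> (h : H) n : (h *+ n) f = h f *+ n.
  by elim: n => [|n IHn]; rewrite ?mulr0n // !mulrS endoD IHn.
rewrite -scaler_nat (card_unit_natr q0) scaleN1r //.
Qed.

Lemma torus_shift_omega z : S z * omega = omega * S z.
Proof.
rewrite /omega mulr_sumr mulr_suml; apply: eq_bigr => e _.
by rewrite !torus_shiftM; congr S; congr pair; apply/val_inj; exact: mulrC.
Qed.

Lemma tau_omega : tau * omega = omega * tau.
Proof.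
rewrite /omega mulr_sumr mulr_suml [RHS](reindex_inj invg_inj).
by apply: eq_bigr => e _; rewrite tau_torus_shift /swap /= invgK.
Qed.

Definition sign_shift : H := S (unit_opp 1%g, 1%g).

Lemma theta_sign_shift : theta = sign_shift * omega.
Proof.
rewrite /omega mulr_sumr; apply: eq_bigr => e _; rewrite torus_shiftM.
have -> // : (unit_opp e^-1, e)%g = ((unit_opp 1, 1) * (e^-1, e))%g.
by apply: (congr2 pair); [rewrite [RHS]/= /unit_opp mulg1|rewrite [RHS]/= mul1g].
Qed.

Lemma sign_shiftK : sign_shift * sign_shift = 1.
Proof.
rewrite torus_shiftM -torus_shift1; congr S; apply: (congr2 pair);
  last by rewrite [LHS]/= mulg1.
by apply/val_inj; rewrite /= !mulr1 mulrNN mulr1.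
Qed.

Lemma sign_shift_tau_omega : sign_shift * tau * omega = tau * sign_shift * omega.
Proof.
rewrite torus_shift_tau -!mulrA; congr (_ * _).
(* [diag(1, -1)] and [diag(-1, 1)] differ by a factor absorbed in [omega]. *)
rewrite -[in RHS](coroot_omega (unit_opp 1%g)) mulrA torus_shiftM;
  congr (S _ * _).
apply: (congr2 pair); apply/val_inj => /=; last by rewrite !mulr1 mul1r.
by rewrite !mulr1 mulrV ?unitrN1.
Qed.

Lemma tau_weight_op m f : tau f = 0 -> tau (weight_op iota m f) = 0.
Proof.
move=> tf; rewrite endo_sum (big_morph tau (endo_add _) (linear0 _)) big1 // =>
  e _.
rewrite endoM homothetyE endo_homothety -endoM tau_torus_shift endoM tf.
by rewrite linear0 scaler0.
Qed.

Lemma weight_op0 f : weight_op iota 0 f = omega f.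
Proof.
rewrite !endo_sum; apply: eq_bigr => e _.
by rewrite endoM homothetyE expr0 invr1 scale1r.
Qed.

(** A geometric sum of roots of unity. *)
Lemma sum_unit_expV (e : {unit k}) :
  \sum_(m < N) iota (val e) ^- m = - (e == 1%g)%:R.
Proof.
have [->|e1] := eqVneq e 1%g.
  rewrite (eq_bigr (fun=> 1)); last by move=> m _; rewrite rmorph1 expr1n invr1.
  rewrite sumr_const card_ord; apply/eqP; rewrite -addr_eq0 -mulrSr.
  by rewrite card_predK q0.
have x1 : (iota (val e))^-1 - 1 != 0.
  rewrite subr_eq0 -fmorphV -(rmorph1 iota) (inj_eq (fmorph_inj iota)).
  by rewrite invr_eq1 -[1]/(val (1 : {unit k})%g) (inj_eq val_inj).
rewrite oppr0; apply: (mulfI x1); rewrite mulr0.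
under eq_bigr => m _ do rewrite -exprVn.
rewrite -subrX1 exprVn -rmorphXn expf_pred_card ?rmorph1 ?invr1 ?subrr //.
exact: (unit_nz e).
Qed.

Lemma sum_weight_op f : \sum_(m < N) weight_op iota m f = - f.
Proof.
under eq_bigr => m _ do rewrite endo_sum; rewrite exchange_big.
transitivity (\sum_(e : {unit k}) - (e == 1%g)%:R *: S (e^-1%g, e) f).
  apply: eq_bigr => e _; rewrite -sum_unit_expV scaler_suml.
  by apply: eq_bigr => m _; rewrite endoM homothetyE.
rewrite (bigD1 1%g) // big1 => [|e e1]; last first.
  by rewrite (negPf e1) oppr0 scale0r.
have -> : (1^-1, 1)%g = 1%g :> {unit k} * {unit k} by rewrite invg1.
by rewrite [LHS]addr0 eqxx scaleN1r torus_shift1.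
Qed.

Hypothesis k_pchar : #|k| \in [pchar k].

(** Decompose [f] into weights: [tau] exchanges the weights [m] and [- m], so it
kills each component, and the component of weight [0] is [- omega f]. *)
Lemma tau_exact f : tau f = 0 -> omega f = 0 -> exists f', tau f' = f.
Proof.
move=> tf of0; suff [f' f'E] : exists f', tau f' = - f.
  by exists (- f'); rewrite -scaleN1r endo_homothety f'E scaleN1r opprK.
rewrite -sum_weight_op; elim/big_ind: _ => [|_ _ [g <-] [g' <-]|m _].
- by exists 0; rewrite linear0.
- by exists (g + g'); rewrite endo_add.
have [m0|m0] := posnP m.
  by exists 0; rewrite m0 weight_op0 of0 linear0.
apply: (tau_exact_weight k_pchar (m := m)); rewrite ?m0 ?ltn_ord //.
  exact: weight_op_weight.
exact: tau_weight_op.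
Qed.

(** In weight [0] the operator [- sign_shift * tau] is idempotent, with
complement proportional to [tau']. If [e] is this idempotent, then [tau] is
[theta * e] and [2 tau + sign_shift] is [theta^-1 * (2 e - 1)], which is the
contraction; the factor [omega] is minus the projector on weight [0]. *)
Lemma contraction_eps :
  (tau *+ 2 + sign_shift) * omega * tau' + tau *
    ((tau *+ 2 + sign_shift) * omega) = omega.
Proof.
set X := tau * sign_shift * omega.
have ttw : tau * tau * omega = - X.
  rewrite tau_tau // theta_sign_shift -[sign_shift * omega * tau]mulrA
    -tau_omega mulrA.
  by rewrite -mulrA omega_omega mulrN sign_shift_tau_omega.
have twt : tau * omega * tau = - X by rewrite -mulrA -tau_omega mulrA ttw.
have swt : sign_shift * omega * tau = X by rewrite -mulrA -tau_omega mulrA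
  sign_shift_tau_omega.
have tws : tau * omega * theta = - X.
  rewrite theta_sign_shift -[LHS]mulrA [omega * _]mulrA -torus_shift_omega
    -[sign_shift * _ * _]mulrA.
  by rewrite omega_omega !mulrN mulrA.
have sws : sign_shift * omega * theta = - omega.
  rewrite theta_sign_shift -[LHS]mulrA [omega * _]mulrA -torus_shift_omega
    -[sign_shift * _ * _]mulrA.
  by rewrite omega_omega !mulrN mulrA sign_shiftK mul1r.
rewrite /tau' !(mulrDl, mulrDr, mulrN, mulrnAl, mulrnAr, mulrA).
rewrite ttw twt tws swt sws -/X !opprK !subrK.
by rewrite -[X + X + _]addrA addKr addrAC subrr add0r.
Qed.

(** Cut [C] by the idempotents [- omega] and [pi = 1 + omega]. On the image of
[pi], [tau] squares to zero and is exact, so for a linear section [s'] of [tau]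
onto its image, [f |-> s' (f - s' (tau f))] contracts [tau]; on the image of
[omega] the contraction is that of [contraction_eps]. *)
Lemma flat_prime_field :
  flat (induced_endo (upper_unip k) L : lmodType (endo (upper_unip k) L)).
Proof.
have [s sP] := linear_section (tau : {linear C -> C}).
pose pi : H := 1 + omega.
have pi_tau : pi * tau = tau * pi by rewrite /pi mulrDl mulrDr tau_omega mul1r
  mulr1.
have pi_pi : pi * pi = pi.
  by rewrite {1}/pi mulrDl mul1r /pi mulrDr mulr1 omega_omega subrr addr0.
have omega_pi : omega * pi = 0 by rewrite /pi mulrDr mulr1 omega_omega subrr.
have theta_pi : theta * pi = 0 by rewrite theta_sign_shift -mulrA omega_pi mulr0.
have piC f : pi (tau f) = tau (pi f) by rewrite -!endoM pi_tau.
have piK f : pi (pi f) = pi f by rewrite -endoM pi_pi.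
have pi_tau' : pi * tau' = tau * pi.
  rewrite /tau' mulrBr pi_tau theta_sign_shift mulrA /pi mulrDl mul1r
    -torus_shift_omega mulrDl.
  by rewrite -[sign_shift * _ * _]mulrA omega_omega mulrN !subrr subr0.
have tau_tau_pi : tau * tau * pi = 0.
  by rewrite tau_tau // -mulrA -pi_tau mulrA theta_pi mul0r.
have tau_tau_pi0 f : tau (tau (pi f)) = 0.
  by rewrite -(endoM tau tau) -endoM tau_tau_pi.
pose s' (f : C) : C := pi (s (pi f)).
have s'_linear : linear s' by move=> a f f'; rewrite /s' !linearP.
have s'_pi f : pi (s' f) = s' f by rewrite /s' piK.
have tau_s' f : tau (s' (tau f)) = pi (tau f).
  rewrite /s' -piC (piC f) sP.
  exact: (etrans (piC (pi f)) (congr1 tau (piK f))).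
pose y f := pi f - s' (tau (pi f)).
pose eps : H := (tau *+ 2 + sign_shift) * omega.
pose P f := s' (y f) - eps f.
have P_linear : linear P.
  have combine a (u v u' v' : C) :
      a *: u + v - (a *: u' + v') = a *: (u - u') + (v - v').
    by rewrite scalerBr opprD addrACA.
  move=> a f f'; rewrite /P /y.
  by rewrite !(endo_equivariant _).1 s'_linear combine s'_linear combine.
have tau_y f : tau (y f) = 0.
  rewrite /y endo_add -scaleN1r endo_homothety tau_s' scaleN1r.
  by rewrite piC piK subrr.
have pi_y f : pi (y f) = y f.
  by rewrite /y endo_add -scaleN1r endo_homothety s'_pi piK.
have omega_y f : omega (y f) = 0 by rewrite -pi_y -endoM omega_pi.
have tau_s'_y f : tau (s' (y f)) = y f.
  by have [x xE] := tau_exact (tau_y f) (omega_y f); rewrite -xE tau_s' xE pi_y.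
have eps_tau' f : eps (tau' f) = omega f - tau (eps f).
  by apply/eqP; rewrite eq_sym subr_eq -!endoM -endoD contraction_eps.
have tau_P f : tau (P f) = y f - tau (eps f).
  by rewrite /P endo_add -scaleN1r endo_homothety scaleN1r tau_s'_y.
have y_tau' f : y (tau' f) = tau (pi f).
  rewrite /y -[pi (tau' f)]endoM pi_tau' endoM tau_tau_pi0.
  by rewrite [s' _](_ : _ = 0) ?subr0 // /s' !linear0.
have cancel_terms (a w t g : C) : a - (w - t) + (g - a - t) = g - w.
  by rewrite opprB [a + _]addrA -[g - a - t]addrA -opprD [LHS]addrC [LHS]addrA
    subrK.
have htpy f : P (tau' f) + tau (P f) = f.
  by rewrite tau_P /P y_tau' eps_tau' /y cancel_terms endoD addrK.
exact: (homotopy_flat q0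
  (P := HB.pack P (GRing.isLinear.Build _ _ _ _ _ P_linear)) htpy).
Qed.

End Flat.

Theorem proposition2p2 (k : finFieldType) (p : nat)
  (hp : p \in [pchar k])
  (Fpbar : closedFieldType) (iota : {rmorphism k -> Fpbar})
  (halg : integralRange iota) :
  flat (induced_endo (upper_unip k) Fpbar :
          lmodType (endo (upper_unip k) Fpbar))
  <-> #|k| = p.
Proof.
split=> [flatC|kp]; last by apply: (flat_prime_field iota); rewrite kp.
apply/eqP; apply: contraPT flatC => neq; apply: (@not_flat_of_lt _ p _ iota hp).
have p_pr := pcharf_prime hp.
have : (p %| #|k|)%N by rewrite (dvdn_pcharf hp)
  (card_natr0 (idfun : {rmorphism k -> k})).
(* A multiple of [p] other than [p] is at least [2 p], so [p < #|k| - 1]. *)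
case/dvdnP=> [[|[|n]]] kE.
- by have := finNzRing_gt1 k; rewrite kE.
- by rewrite kE mul1n eqxx in neq.
rewrite kE -subn1 ltn_subRL addnC !mulSn ltn_add2l.
by rewrite ltn_addr // prime_gt1.
Qed.
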